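(* Let $p>1$, $p'=\frac p{p-1}$. Let $f>0$ be lower semicontinuous in $(0,1)$, and let $h:[0,1]\to\mathbb{R}$ be continuous at $0$, bounded and piecewise continuous on $[0,1]$ (as specified in the context). Assume $$0<\mu:=\sup_{t\in(0,1)}\frac{f(t)}{t^{p'-1}}<+\infty .$$ Put $H(1)=\int_0^1h(s)\,ds$ and $h_M=\sup_{0\le t\le1}h(t)$. For $c\in\mathbb{R}$ consider the boundary value problem $$(B_c)\qquad y'(t)=p'\Big[(c-h(t))(y^+(t))^{\frac1p}-f(t)\Big],\ t\in(0,1),\qquad y(0)=0=y(1).$$ Then, in the case $h(0)>H(1)$, there exists a number $$c^*\in\big[h(0),\ h_M+(p')^{\frac1{p'}}p^{\frac1p}\mu^{\frac1{p'}}\big]$$ such that $(B_c)$ has a unique positive solution if and only if $c\ge c^*$. In the case $h(0)\le H(1)$, the same result holds for $$c^*\in\big(H(1),\ h_M+(p')^{\frac1{p'}}p^{\frac1p}\mu^{\frac1{p'}}\big].$$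
   Context: $y^+=\max\{y,0\}$. A solution of $(B_c)$ is meant in the sense of Carathéodory: an absolutely continuous function $y$ on $[0,1]$ satisfying the differential equation almost everywhere in $(0,1)$ and the boundary conditions. Positive means $y>0$ in $(0,1)$. Hypothesis on $h$: there are $0=k_0<k_1<\dots<k_q<k_{q+1}=1$ such that $h$ has a jump discontinuity at $k_j$ (finite one-sided limits), $j=1,\dots,q$, and $h|_{(k_j,k_{j+1})}$ is continuous, $j=0,\dots,q$; moreover $h$ is bounded on $[0,1]$ and continuous at $0$. *)

(* Defs.v *)
From mathcomp Require Import all_boot all_order all_algebra.
From mathcomp Require Import all_classical all_reals all_analysis.

Set Implicit Arguments.
Unset Strict Implicit.
Unset Printing Implicit Defensive.

Import Order.TTheory GRing.Theory Num.Theory.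
Import numFieldNormedType.Exports.

Local Open Scope classical_set_scope.
Local Open Scope ring_scope.

(* All functions are total on R; only their values on [0, 1] (for h and the
   solution y) or on ]0, 1[ (for f) are ever used. *)

Definition conj_exponent (R : realType) (p : R) : R := p / (p - 1).

Definition pos_part (R : realType) (x : R) : R := Num.max x 0.

Definition absolutely_continuous (R : realType) (a b : R) (g : R -> R) : Prop :=
  forall e : R, 0 < e -> exists2 d : R, 0 < d &
    forall (n : nat) (u v : 'I_n -> R),
      (forall i, [/\ a <= u i, u i < v i & v i <= b]) ->
      trivIset setT (fun i => `]u i, v i[%classic) ->
      \sum_(i < n) (v i - u i) < d ->
      \sum_(i < n) `|g (v i) - g (u i)| < e.

Definition jump_discontinuity (R : realType) (h : R -> R) (x : R) : Prop :=
  exists l r : R, [/\ h t @[t --> x^'-] --> l, h t @[t --> x^'+] --> r & l != r].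

(* The nodes are 0 = k 0 < k 1 < ... < k q < k q.+1 = 1; q = 0 is allowed, and
   values of k beyond q.+1 are irrelevant. *)
Definition piecewise_continuous01 (R : realType) (h : R -> R) : Prop :=
  exists (q : nat) (k : nat -> R),
    [/\ k 0%N = 0, k q.+1 = 1,
        forall j, (j <= q)%N -> k j < k j.+1,
        forall j, (0 < j <= q)%N -> jump_discontinuity h (k j) &
        forall j, (j <= q)%N -> {in `]k j, k j.+1[, continuous h}].

(* The topology of [subspace A] is the trace topology on A and is discrete
   outside A, so nothing is required at the points outside A. *)
Definition lower_semicontinuous_on (R : realType) (A : set R) (f : R -> R) :
    Prop :=
  @lower_semicontinuous (subspace A) R (fun t => (f t)%:E).

(* Solutions of y' = p' ((c - h) (y^+)^(1/p) - f), y(0) = 0 = y(1), in the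
   sense of Caratheodory. *)
Definition bvp_solution (R : realType) (p : R) (f h : R -> R) (c : R)
    (y : R -> R) : Prop :=
  [/\ absolutely_continuous 0 1 y,
      {ae (@lebesgue_measure R), forall t : R, t \in `]0, 1[ ->
        is_derive t 1 y
          (conj_exponent p *
             ((c - h t) * pos_part (y t) `^ p^-1 - f t))},
      y 0 = 0 & y 1 = 0].

Definition positive_bvp_solution (R : realType) (p : R) (f h : R -> R) (c : R)
    (y : R -> R) : Prop :=
  bvp_solution p f h c y /\ {in `]0, 1[, forall t, 0 < y t}.

(* Two solutions are identified when they agree on [0, 1]. *)
Definition has_unique_positive_solution (R : realType) (p : R) (f h : R -> R)
    (c : R) : Prop :=
  exists2 y : R -> R, positive_bvp_solution p f h c y &
    forall z : R -> R, positive_bvp_solution p f h c z -> {in `[0, 1], z =1 y}.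

(* Main.v *)
Require Import Defs.
From mathcomp Require Import all_boot all_order all_algebra.
From mathcomp Require Import all_classical all_reals all_analysis.
From mathcomp Require Import measurable_realfun.
From mathcomp Require Import ring lra.

Import Order.TTheory GRing.Theory Num.Theory.
Import numFieldNormedType.Exports.

Local Open Scope classical_set_scope.
Local Open Scope ring_scope.

(** Write w = y^(1/p'). For a positive solution of (B_c) the equation becomes
w' = c - h - f / y^(1/p), and because f > 0 its right-hand side increases with w.
Hence the difference of two positive solutions moves away from 0 forward in time,
and solutions that meet at t = 1 are controlled by their equations on the whole of
[0, 1] ([backward_comparison]). In particular at most one function Y_c is positive
on ]0, 1[, solves the equation and vanishes at 1 ([terminal_solution_unique]), so
that (B_c) has a positive solution, necessarily unique, if and only if
Y_c 0 = 0.

Comparing the functions w_c of two speeds shows that c |-> w_c 0 is nonincreasing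
([desingularize_nonincreasing]) and 1-Lipschitz ([desingularize_lipschitz]). The
set C of the speeds c with Y_c 0 = 0 is therefore closed and upward closed, and
c* is its minimum once C is nonempty and bounded below.
- C is nonempty: since f t <= mu t^(p' - 1), the line k t bounds w_c from above as
  soon as c >= hM + k + mu k^(1 - p') ([desingularize_le_linear]), which forces
  w_c 0 = 0; the best slope k gives the upper end of the announced interval
  ([optimal_slope]).
- C is bounded below by h 0, as otherwise y would decrease just after 0
  ([speed_ge_h0]), and by H(1), strictly, as is seen by integrating w' over ]0, 1[
  ([speed_gt_mean]). The second bound is strict at c* because c* belongs to C.

It remains to construct Y_c. The equation is merely measurable in t and not
Lipschitz in y, so existence with y 1 = 0 comes from a compactness argument on
delayed equations ([peano_backward], [caratheodory_solution_exists]); positivity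
on ]0, 1[ holds because the lower semicontinuous f is bounded below by a positive
constant near every interior point ([caratheodory_solution_gt0]).

Solutions are differentiable only almost everywhere. What turns the sign of their
derivative into monotonicity is [ac_nondecreasing], which is proved by induction
along the segment ([real_induction]). *)

(** Induction over a segment: the supremum s of the points of [a, b] reachable
from a satisfies P because the step around s joins a reachable point on its left
to s, and the same step reaches beyond s unless s = b. *)
Lemma real_induction {R : realType} (a b : R) (P : R -> Prop) :
  a <= b -> P a ->
  (forall t, a <= t <= b -> exists2 r, 0 < r &
     forall u v, a <= u <= t -> t <= v <= b -> t - r < u -> v < t + r ->
       P u -> P v) ->
  P b.
Proof.
move=> ab Pa step.
pose S := [set x | a <= x <= b /\ P x].
have Sa : S a by split => //; rewrite lexx.
have ubS : ubound S b by move=> x [/andP[]].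
have hsS : has_sup S by split; [exists a|exists b].
have as_ : a <= sup S by apply: ub_le_sup => //; exists b.
have sb : sup S <= b by apply: ge_sup => //; exists a.
have [|r r0 stepr] := step (sup S); first by rewrite as_ sb.
have [u [/andP[au ub] Pu] ur] : exists2 u, S u & sup S - r < u.
  exact: sup_adherent.
have us : u <= sup S by apply: ub_le_sup => //; [exists b|split => //; rewrite au].
have key v : sup S <= v <= b -> v < sup S + r -> P v.
  by move=> svb vr; apply: (stepr u v) => //; rewrite au us.
have [br|rb] := ltP b (sup S + r); first by apply: key; rewrite ?sb ?lexx.
have : S (sup S + r / 2).
  split; first by apply/andP; split; lra.
  by apply: key; [apply/andP; split|]; lra.
move=> /(ub_le_sup _) => /(_ (ex_intro _ b ubS)); lra.
Qed.

(** * Absolutely continuous functions *)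

Section absolute_continuity.
Context {R : realType}.
Implicit Types (a b : R) (g : R -> R).

Lemma ac_lipschitz a b g (K : R) :
  (forall s t, a <= s -> s <= t -> t <= b -> `|g t - g s| <= K * (t - s)) ->
  absolutely_continuous a b g.
Proof.
move=> gK e e0; exists (e / (`|K| + 1)); first by rewrite divr_gt0// ltr_pwDr.
move=> n u v uv _ uve.
have K1 : 0 < `|K| + 1 by rewrite ltr_pwDr.
apply: (@le_lt_trans _ _ (\sum_(i < n) (`|K| + 1) * (v i - u i))).
  apply: ler_sum => i _; have [aui uvi vib] := uv i.
  apply: le_trans (gK _ _ aui (ltW uvi) vib) _.
  by apply: ler_wpM2r; [lra|have := ler_norm K; lra].
by rewrite -mulr_sumr mulrC -ltr_pdivlMr.
Qed.

Lemma ac_comp_lipschitz a b g (phi : R -> R) (K : R) :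
  absolutely_continuous a b g ->
  (forall s t, a <= s <= b -> a <= t <= b ->
     `|phi (g t) - phi (g s)| <= K * `|g t - g s|) ->
  absolutely_continuous a b (phi \o g).
Proof.
move=> acg phiK e e0.
have K1 : 0 < `|K| + 1 by rewrite ltr_pwDr.
have [|d d0 gd] := acg (e / (`|K| + 1)); first by rewrite divr_gt0.
exists d => // n u v uv tr uvd.
apply: (@le_lt_trans _ _ (\sum_(i < n) (`|K| + 1) * `|g (v i) - g (u i)|)).
  apply: ler_sum => i _; have [aui uvi vib] := uv i.
  apply: le_trans (phiK _ _ _ _) _; [by apply/andP; split; lra..|].
  by apply: ler_wpM2r => //; have := ler_norm K; lra.
by rewrite -mulr_sumr mulrC -ltr_pdivlMr//; exact: gd.
Qed.

Lemma acD a b g1 g2 : absolutely_continuous a b g1 ->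
  absolutely_continuous a b g2 -> absolutely_continuous a b (g1 \+ g2).
Proof.
move=> ac1 ac2 e e0.
have [|d1 d10 gd1] := ac1 (e / 2); first by rewrite divr_gt0.
have [|d2 d20 gd2] := ac2 (e / 2); first by rewrite divr_gt0.
exists (Num.min d1 d2) => [|n u v uv tr]; first by rewrite lt_min d10.
rewrite lt_min => /andP[uv1 uv2].
apply: (@le_lt_trans _ _ (\sum_(i < n) (`|g1 (v i) - g1 (u i)| +
                                        `|g2 (v i) - g2 (u i)|))).
  apply: ler_sum => i _ /=; rewrite opprD addrACA; exact: ler_normD.
by rewrite big_split/= [e]splitr ltrD// ?gd1 ?gd2.
Qed.

Lemma acN a b g : absolutely_continuous a b g ->
  absolutely_continuous a b (\- g).
Proof.
move=> acg; apply: (ac_comp_lipschitz _ _ g -%R 1 acg) => s t _ _.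
by rewrite mul1r -opprD normrN.
Qed.

Lemma ac_sub a b a' b' g : a <= a' -> b' <= b ->
  absolutely_continuous a b g -> absolutely_continuous a' b' g.
Proof.
move=> aa bb acg e e0; have [d d0 gd] := acg e e0; exists d => // n u v uv.
by apply: gd => i; have [? ? ?] := uv i; split => //; lra.
Qed.

Lemma ac_continuous a b g : absolutely_continuous a b g ->
  {within `[a, b], continuous g}.
Proof.
move=> acg.
have key e : 0 < e -> exists2 d, 0 < d & forall s t, a <= s -> s < t -> t <= b ->
    t - s < d -> `|g t - g s| < e.
  move=> e0; have [d d0 gd] := acg e e0; exists d => // s t as_ st tb ts.
  have := gd 1%N (fun=> s) (fun=> t); rewrite !big_ord1; apply => //.
  by move=> i j _ _ _; rewrite !ord1.
apply/subspace_continuousP => x /=; rewrite in_itv/= => /andP[ax xb].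
apply/cvgrPdist_lt => e e0; have [d d0 gd] := key e e0; rewrite near_withinE; near=> y.
rewrite /= in_itv/= => /andP[ay yb].
have xyd : `|x - y| < d by near: y; apply: nbhsx_ballx.
have /andP[xyd1 xyd2] : - d < x - y < d by rewrite -ltr_norml.
have [xy|yx|->] := ltgtP x y; last by rewrite subrr normr0.
- by rewrite distrC gd//; lra.
- by rewrite gd//; lra.
Unshelve. all: by end_near. Qed.

End absolute_continuity.

Section ac_nondecreasing.
Context {R : realType}.
Local Notation mu := (@lebesgue_measure R).

(** The increments are taken over intervals that straddle the point t, which is
what makes them composable in a real induction: the two halves at t are each
controlled by the difference quotient. *)
Lemma derive_ge0_local (g : R -> R) (t l e : R) :
  is_derive t 1 g l -> 0 <= l -> 0 < e ->
  exists2 r, 0 < r & forall u v, u <= t <= v -> t - r < u -> v < t + r ->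
    g u - g v <= e * (v - u).
Proof.
move=> [dg gl] l0 e0; have gq : h^-1 *: (g (h *: 1 + t) - g t) @[h --> 0^'] --> l.
  by rewrite -gl; exact: dg.
have /nbhs_ballP[r /= r0 rP] : \forall h \near nbhs (0 : R), h != 0 ->
    l - e < h^-1 *: (g (h *: 1 + t) - g t).
  have : \forall h \near 0^', l - e < h^-1 *: (g (h *: 1 + t) - g t).
    by apply: (cvgr_gt _ gq); lra.
  by rewrite near_withinE.
have key h : h != 0 -> `|h| < r -> l - e < h^-1 * (g (h + t) - g t).
  move=> h0 hr; have := rP h; rewrite /ball/= sub0r normrN => /(_ hr h0).
  by rewrite /GRing.scale/= mulr1.
exists r => // u v /andP[ut tv] ru vr.
have kv : g t - g v <= e * (v - t).
  move: tv; rewrite le_eqVlt => /predU1P[->|tv]; first lra.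
  have vt0 : 0 < v - t by lra.
  have := key (v - t); rewrite gt_eqF// gtr0_norm// subrK => /(_ isT).
  rewrite mulrC ltr_pdivlMr// => /(_ _); have : v - t < r by lra.
  by move=> -> => /(_ isT) vt; have : 0 <= l * (v - t); [rewrite mulr_ge0// ltW|lra].
have ku : g u - g t <= e * (t - u).
  move: ut; rewrite le_eqVlt => /predU1P[->|ut]; first lra.
  have ut0 : 0 < t - u by lra.
  have := key (u - t); rewrite lt_eqF ?subr_lt0// ltr0_norm ?subr_lt0//.
  rewrite subrK => /(_ isT).
  rewrite mulrC -[X in X / _]opprK -[X in _ / X]opprK invrN mulrNN opprB.
  rewrite ltr_pdivlMr ?opprB// => /(_ _); have : t - u < r by lra.
  by move=> -> => /(_ isT) vt; have : 0 <= l * (t - u); [rewrite mulr_ge0// ltW|lra].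
by lra.
Qed.

Let ext (n : nat) (x : R) (u : 'I_n -> R) (i : 'I_n.+1) :=
  if unlift ord0 i is Some j then u j else x.

Let ext0 n x u : @ext n x u ord0 = x.
Proof. by rewrite /ext unlift_none. Qed.

Let extS n x u i : @ext n x u (lift ord0 i) = u i.
Proof. by rewrite /ext liftK. Qed.

(** Fix e > 0 and enclose the exceptional null set in an open set U so small that
the increments of g over disjoint intervals of U add up to less than e. Going from
a to b by real induction, g loses at most k times the distance around the points
where its derivative is nonnegative, and around an exceptional point it loses at
most its increment over an interval of U, which is added to a growing disjoint
family. The total loss is therefore at most k (b - a) + e / 2 <= e. *)
Lemma ac_nondecreasing (a b : R) (g : R -> R) : a <= b ->
  absolutely_continuous a b g ->
  {ae mu, forall t : R, t \in `]a, b[ -> exists2 l, 0 <= l & is_derive t 1 g l} ->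
  g a <= g b.
Proof.
move=> ab acg [A [mA A0 AN]].
apply/ler_addgt0Pr => e e0.
have [|d d0 gd] := acg (e / 2); first by rewrite divr_gt0.
(* the endpoints are made exceptional, as nothing is known of g' there *)
pose A' := A `|` ([set a] `|` [set b]).
have mA' : measurable A' by apply: measurableU => //; exact: measurableU.
have muA' : mu A' = 0%E.
  have mab : measurable ([set a] `|` [set b]) by exact: measurableU.
  have set0_ x : mu [set x] = 0%E := lebesgue_measure_set1 x.
  apply: etrans (measureU0 mA mab _) A0.
  by apply: etrans (measureU0 _ _ _) (set0_ a) => //; exact: set0_.
have muA'y : (mu A' < +oo)%E by rewrite muA' ltry.
have [U [oU AU muU]] := lebesgue_regularity_outer mA' muA'y d0.
have mU : measurable U by exact: open_measurable.
have {}muU : (mu U < d%:E)%E.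
  have UA0 : mu (U `&` A') = 0%E.
    apply: (subset_measure0 _ mA' _ muA'); last exact: subIsetr.
    exact: measurableI.
  apply: le_lt_trans muU; rewrite le_eqVlt; apply/orP; left; apply/eqP.
  apply: etrans (measureDI mu mU mA') _.
  exact: etrans (congr1 (adde _) UA0) (adde0 _).
(* the + 1 keeps the slope k finite when a = b *)
pose k := e / 2 / (b - a + 1).
have k0 : 0 < k by rewrite !divr_gt0//; lra.
pose P x := exists n (u v : 'I_n -> R),
  [/\ forall i, [/\ a <= u i, u i < v i & v i <= x],
      trivIset setT (fun i => `]u i, v i[%classic),
      forall i, `]u i, v i[ `<=` U &
      g a - g x <= k * (x - a) + \sum_(i < n) `|g (v i) - g (u i)|].
have [n [u [v [uv tr uvU gab]]]] : P b.
  apply: (real_induction a b P ab).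
    exists 0%N, (fun=> 0), (fun=> 0); split; [by case|by case|by case|].
    by rewrite big_ord0 !subrr mulr0 addr0.
  move=> t /andP[at_ tb].
  have [tA|tA] := pselect (A' t).
    (* an exceptional point: a neighbourhood of it lies in U *)
    have /nbhs_ballP[r /= r0 rU] : nbhs t U.
      by apply: open_nbhs_nbhs; split => //; exact: AU.
    exists r => // x y /andP[ax xt] /andP[ty yb] rx yr [n [u [v [uv tr uvU gax]]]].
    have [xy|xy] := ltP x y; last first.
      have <- : x = y by lra.
      by exists n, u, v; split.
    exists n.+1, (ext n x u), (ext n y v); split.
    + move=> i; case: (unliftP ord0 i) => [j ->|->].
        by rewrite !extS; have [? ? ?] := uv j; split => //; lra.
      by rewrite !ext0; split.
    + move=> i j _ _ [z []] /=; rewrite !in_itv/=.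
      case: (unliftP ord0 i) => [i' ->|->]; case: (unliftP ord0 j) => [j' ->|->] //.
      * rewrite !extS => z1 z2; congr (lift ord0 _).
        by apply: tr => //; exists z; split; rewrite /= in_itv.
      * by rewrite !extS !ext0 => /andP[_ ?] /andP[? _]; have [_ _ ?] := uv i'; exfalso; lra.
      * by rewrite !extS !ext0 => /andP[? _] /andP[_ ?]; have [_ _ ?] := uv j'; exfalso; lra.
    + move=> i; case: (unliftP ord0 i) => [j ->|->]; first by rewrite !extS.
      rewrite !ext0 => z /=; rewrite in_itv/= => /andP[xz zy]; apply: rU.
      by rewrite /ball/= ltr_norml; apply/andP; split; lra.
    + rewrite big_ord_recl !ext0; under eq_bigr do rewrite !extS.
      have := ler_norm (g x - g y); rewrite distrC => gxy.
      by have : 0 <= k * (y - x); [rewrite mulr_ge0// ltW// subr_gt0|lra].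
  have tab : t \in `]a, b[.
    by rewrite in_itv/= !lt_neqAle at_ tb !andbT; apply/andP; split;
      apply/eqP => tE; apply: tA; right; [left|right].
  have [l l0 gl] : exists2 l, 0 <= l & is_derive t 1 g l.
    apply: contrapT => gt; apply: tA; left; apply: AN => /= /(_ tab) //.
  have [r r0 rP] := derive_ge0_local g t l k gl l0 k0.
  exists r => // x y /andP[ax xt] /andP[ty yb] rx yr [n [u [v [uv tr uvU gax]]]].
  exists n, u, v; split => //.
    by move=> i; have [? ? ?] := uv i; split => //; lra.
  by have := rP x y; rewrite xt ty => /(_ isT rx yr); lra.
have uvd : \sum_(i < n) (v i - u i) < d.
  rewrite -lte_fin; apply: le_lt_trans muU.
  rewrite -sumEFin (_ : (\sum_(i < n) _)%E = \sum_(i < n) mu `]u i, v i[)%E; last first.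
    apply: eq_bigr => i _; rewrite lebesgue_measure_itv/= lte_fin.
    by have [_ -> _] := uv i.
  rewrite -(@measure_bigsetU_ord _ _ _ mu n xpredT)// le_measure ?inE//.
    by apply: bigsetU_measurable.
  by apply: (big_ind (fun S => S `<=` U)) => // S T SU TU z [/SU|/TU].
have gs := gd n u v uv tr uvd.
have kb : k * (b - a) <= e / 2.
  rewrite /k -mulrA ler_piMr ?divr_ge0 ?ltW//.
  by rewrite mulrC ltr_pdivrMr ?mul1r; lra.
lra.
Qed.
End ac_nondecreasing.

(** * Backward comparison *)

Section backward_comparison.
Context {R : realType}.
Local Notation mu := (@lebesgue_measure R).

Lemma aeS (P Q : R -> Prop) : (forall t, P t -> Q t) ->
  {ae mu, forall t, P t} -> {ae mu, forall t, Q t}.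
Proof. by apply: filterS; first exact: (ae_filter_ringOfSetsType mu). Qed.

Lemma aeS2 (P Q S : R -> Prop) : (forall t, P t -> Q t -> S t) ->
  {ae mu, forall t, P t} -> {ae mu, forall t, Q t} -> {ae mu, forall t, S t}.
Proof. by apply: filterS2; first exact: (ae_filter_ringOfSetsType mu). Qed.

Lemma within_continuous_dist (a b : R) (d : R -> R) (x e : R) :
  {within `[a, b], continuous d} -> a <= x <= b -> 0 < e ->
  exists2 r, 0 < r & forall y, a <= y <= b -> `|y - x| < r -> `|d y - d x| < e.
Proof.
move=> /subspace_continuousP dc xab e0.
have /cvgrPdist_lt/(_ e e0) : d y @[y --> within `[a, b] (nbhs x)] --> d x.
  by apply: dc; rewrite /= in_itv.
rewrite near_withinE => /nbhs_ballP[r /= r0 rP]; exists r => // y yab yx.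
by rewrite distrC; apply: rP; rewrite /ball/= ?in_itv// distrC.
Qed.

(** A function that cannot decrease while it is positive, and that ends at a
nonpositive value, was never positive. Indeed, if d t0 > 0, then the property
d t0 <= d x propagates from t0 to b by real induction: where d is positive it is
nondecreasing, and near a point where d is not positive no x has the property. The
derivative is needed only almost everywhere on ]a, b[ and d may be singular at the
ends, which are reached by continuity. *)
Lemma backward_comparison (a b : R) (d : R -> R) :
  {within `[a, b], continuous d} ->
  (forall s t, a < s -> s <= t -> t < b -> absolutely_continuous s t d) ->
  {ae mu, forall t : R, t \in `]a, b[ -> 0 < d t ->
     exists2 l, 0 <= l & is_derive t 1 d l} ->
  d b <= 0 -> forall t, a <= t <= b -> d t <= 0.
Proof.
move=> dc dac dae db0.
have mono s t : a < s -> s <= t -> t < b -> (forall r, s <= r <= t -> 0 < d r) ->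
    d s <= d t.
  move=> as_ st tb dpos; apply: ac_nondecreasing => //; first exact: dac.
  apply: aeS dae => r rP; rewrite in_itv/= => /andP[sr rt].
  by apply: rP; [rewrite in_itv/=; apply/andP; split; lra|
                 apply: dpos; rewrite !ltW].
have interior t0 : a < t0 <= b -> d t0 <= 0.
  move=> /andP[at0 t0b]; rewrite leNgt; apply/negP => d0.
  suff : d t0 <= d b by lra.
  apply: (real_induction t0 b (fun x => d t0 <= d x) t0b (lexx _)).
  move=> t /andP[t0t tb].
  have tab : a <= t <= b by apply/andP; split; lra.
  have [dt|dt] := ltP 0 (d t).
    have [r r0 rP] := within_continuous_dist a b d t (d t) dc tab dt.
    have tb' : t < b.
      by rewrite lt_neqAle tb andbT; apply/eqP => tE; move: dt; rewrite tE; lra.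
    exists (Num.min r (b - t)); first by rewrite lt_min r0; lra.
    move=> u v /andP[u1 u2] /andP[v1 v2].
    rewrite ltrBlDr -ltrBlDl lt_min => /andP[ur _].
    rewrite -ltrBlDl lt_min => /andP[vr vb].
    move=> /le_trans; apply; apply: mono; [lra|lra|lra|].
    move=> w /andP[uw wv].
    have : `|d w - d t| < d t.
      apply: rP; first by apply/andP; split; lra.
      by rewrite ltr_norml; apply/andP; split; lra.
    by rewrite ltr_norml => /andP[? ?]; lra.
  have [r r0 rP] := within_continuous_dist a b d t (d t0) dc tab d0.
  exists r => // u v /andP[u1 u2] _ ur _ du; exfalso.
  have : `|d u - d t| < d t0.
    apply: rP; first by apply/andP; split; lra.
    by rewrite ltr_norml; apply/andP; split; lra.
  by rewrite ltr_norml => /andP[? ?]; lra.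
move=> t /andP[]; rewrite le_eqVlt => /predU1P[<- ab|? ?]; last first.
  by apply: interior; apply/andP.
move: ab; rewrite le_eqVlt => /predU1P[->//|ab].
rewrite leNgt; apply/negP => d0.
have aab : a <= a <= b by rewrite lexx ltW.
have [r r0 rP] := within_continuous_dist a b d a (d a) dc aab d0.
pose x := a + Num.min (r / 2) (b - a).
have mx : 0 < Num.min (r / 2) (b - a) by rewrite lt_min; apply/andP; split; lra.
have mr : Num.min (r / 2) (b - a) <= r / 2 by rewrite ge_min lexx.
have mb : Num.min (r / 2) (b - a) <= b - a by rewrite ge_min lexx orbT.
have : `|d x - d a| < d a.
  apply: rP; first by apply/andP; split; rewrite /x; lra.
  by rewrite ltr_norml; apply/andP; split; rewrite /x; lra.
rewrite ltr_norml => /andP[? ?].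
suff : d x <= 0 by lra.
by apply: interior; rewrite /x; apply/andP; split; lra.
Qed.

End backward_comparison.

(** * Powers of the positive part *)

Section posroot.
Context {R : realType}.

Definition posroot (q x : R) : R := pos_part x `^ q.

Lemma pos_part_ge0 (x : R) : 0 <= pos_part x.
Proof. by rewrite /pos_part le_max lexx orbT. Qed.

Lemma pos_part_id (x : R) : 0 <= x -> pos_part x = x.
Proof. by rewrite /pos_part => /max_idPl. Qed.

Lemma pos_part_dist (x y : R) : `|pos_part x - pos_part y| <= `|x - y|.
Proof.
rewrite /pos_part; case: (leP x 0) => x0; case: (leP y 0) => y0.
- by rewrite subrr normr0.
- by rewrite !ltr0_norm; lra.
- by rewrite !gtr0_norm; lra.
- by [].
Qed.

(** Both fractions a / (a + b) and b / (a + b) lie in [0, 1], where x <= x^q, and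
they add up to 1. *)
Lemma powR_subadditive (q a b : R) : 0 < q <= 1 -> 0 <= a -> 0 <= b ->
  (a + b) `^ q <= a `^ q + b `^ q.
Proof.
move=> /andP[q0 q1] a0 b0.
have [s0|s0] := leP (a + b) 0.
  have -> : a = 0 by lra.
  have -> : b = 0 by lra.
  by rewrite addr0 powR0 ?gt_eqF// addr0.
have frac x : 0 <= x <= a + b -> x / (a + b) * (a + b) `^ q <= x `^ q.
  move=> /andP[x0 xs].
  have [x0'|x0'] := eqVneq x 0; first by rewrite x0' !mul0r powR_ge0.
  have {2}-> : x = x / (a + b) * (a + b) by rewrite mulfVK// gt_eqF.
  rewrite powRM ?divr_ge0//; [|exact: ltW..].
  apply: ler_wpM2r; first exact: powR_ge0.
  apply: ger1_powR => //; apply/andP; split; last by rewrite ler_pdivrMr// mul1r.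
  by rewrite divr_gt0// lt_neqAle eq_sym x0'.
have := frac a; have := frac b.
have -> : 0 <= b <= a + b by apply/andP; split; lra.
have -> : 0 <= a <= a + b by apply/andP; split; lra.
move=> /(_ isT) fb /(_ isT) fa; apply: le_trans (lerD fa fb).
by rewrite -mulrDl -mulrDl divff ?gt_eqF// mul1r.
Qed.

Lemma posroot_ge0 (q x : R) : 0 <= posroot q x.
Proof. exact: powR_ge0. Qed.

Lemma posroot_homo (q : R) : 0 <= q -> {homo posroot q : x y / x <= y}.
Proof.
move=> q0 x y xy; rewrite /posroot ge0_ler_powR// ?nnegrE ?pos_part_ge0//.
by rewrite /pos_part ge_max !le_max xy lexx orbT.
Qed.

(** Subadditivity of the power gives an explicit modulus of continuity, valid up
to and across 0, where the power is not Lipschitz. *)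
Lemma posroot_holder (q x y : R) : 0 < q <= 1 ->
  `|posroot q x - posroot q y| <= `|x - y| `^ q.
Proof.
move=> q01; wlog xy : x y / y <= x => [hw|].
  by have [/hw//|/ltW/hw] := leP y x; rewrite distrC [`|y - x|]distrC.
have q0 : 0 <= q by have /andP[/ltW] := q01.
rewrite ger0_norm ?subr_ge0 ?posroot_homo// lerBlDl.
rewrite /posroot; apply: le_trans (powR_subadditive _ _ _ q01 _ _) => //.
  rewrite ge0_ler_powR// ?nnegrE ?addr_ge0 ?pos_part_ge0//.
  by rewrite -lerBlDl (le_trans (ler_norm _))// pos_part_dist.
exact: pos_part_ge0.
Qed.

Lemma posroot_uniform (q e : R) : 0 < q <= 1 -> 0 < e -> exists2 d, 0 < d &
  forall x y, `|x - y| < d -> `|posroot q x - posroot q y| < e.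
Proof.
move=> q01 e0; have /andP[q0 _] := q01; exists (e `^ q^-1); first exact: powR_gt0.
move=> x y xy; apply: le_lt_trans (posroot_holder q x y q01) _.
have -> : e = (e `^ q^-1) `^ q by rewrite -powRrM mulVf ?gt_eqF// powRr1// ltW.
by apply: gt0_ltr_powR; rewrite ?nnegrE ?powR_ge0.
Qed.

Lemma posroot_continuous (q : R) : 0 < q <= 1 -> continuous (posroot q).
Proof.
move=> q01 x; apply/cvgrPdist_lt => e /(posroot_uniform q e q01)[d d0 dP].
by near=> y; apply: dP; near: y; apply/nbhs_ballP; exists d.
Unshelve. all: by end_near. Qed.

(** For x >= y > 0 the ratio x / y is at least 1, so (x / y)^q <= x / y, which
bounds the increment by y^(q - 1) (x - y). *)
Lemma posroot_lipschitz (q m x y : R) : 0 < q <= 1 -> 0 < m -> m <= x -> m <= y ->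
  `|posroot q x - posroot q y| <= m `^ (q - 1) * `|x - y|.
Proof.
move=> q01 m0; have /andP[q0 q1] := q01; wlog xy : x y / y <= x => [hw mx my|].
  by have [yx|/ltW yx] := leP y x; [|rewrite distrC [`|x - y|]distrC]; apply: hw.
move=> mx my.
have y0 : 0 < y by lra.
rewrite !ger0_norm ?subr_ge0//; last by rewrite posroot_homo// ltW.
rewrite /posroot !pos_part_id; [|lra..].
have -> : x `^ q = (x / y) `^ q * y `^ q.
  by rewrite -powRM ?mulfVK ?gt_eqF ?divr_ge0//; lra.
apply: (@le_trans _ _ (x / y * y `^ q - y `^ q)).
  rewrite lerD2r; apply: ler_wpM2r; first exact: powR_ge0.
  apply: ler1_powR => //.
  by rewrite ler_pdivlMr// mul1r.
have -> : x / y * y `^ q - y `^ q = (x - y) * y `^ (q - 1).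
  rewrite powRB ?(gt_eqF y0) ?implybT// powRr1 ?ltW//; field.
  by rewrite gt_eqF.
rewrite mulrC; apply: ler_wpM2r; first by rewrite subr_ge0.
have -> : q - 1 = - (1 - q) by rewrite opprB.
rewrite !powRN lef_pV2 ?posrE ?powR_gt0//.
by apply: ge0_ler_powR; rewrite ?nnegrE; lra.
Qed.

Lemma is_derive_posroot (q t l : R) (z : R -> R) : 0 < z t ->
  is_derive t 1 z l ->
  is_derive t 1 (posroot q \o z) (q * z t `^ (q - 1) * l).
Proof.
move=> zt dz; apply: is_derive1_comp.
have dp : is_derive (z t) 1 (fun x => powR x q) (q * z t `^ (q - 1)).
  exact: is_derive1_powR.
apply: near_eq_is_derive dp.
near=> x; rewrite /posroot pos_part_id// ltW//; near: x.
exact: lt_nbhsr.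
Unshelve. all: by end_near. Qed.

End posroot.

(** * Differences of functions up to an affine term *)

Section affine_perturbation.
Context {R : realType}.
Implicit Types (u v : R -> R) (k e : R).

Lemma ac_affine (a b k e : R) : absolutely_continuous a b (fun s => k * s + e).
Proof.
apply: (ac_lipschitz a b _ `|k|) => s t _ st _.
have -> : k * t + e - (k * s + e) = k * (t - s) by ring.
by rewrite normrM [`|t - s|]ger0_norm// subr_ge0.
Qed.

Lemma ac_perturb (a b k e : R) u v :
  absolutely_continuous a b u -> absolutely_continuous a b v ->
  absolutely_continuous a b (fun s => u s - v s + (k * s + e)).
Proof.
move=> acu acv; apply: (acD _ _ (u \- v)); last exact: ac_affine.
exact: (acD _ _ u (\- v)) acu (acN _ _ _ acv).
Qed.

Lemma within_continuous_perturb (a b k e : R) u v :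
  {within `[a, b], continuous u} -> {within `[a, b], continuous v} ->
  {within `[a, b], continuous (fun s => u s - v s + (k * s + e))}.
Proof.
move=> /subspace_continuousP cu /subspace_continuousP cv.
have /subspace_continuousP ca := ac_continuous _ _ _ (ac_affine a b k e).
apply/subspace_continuousP => x xab.
by apply: cvgD; [apply: cvgB; [exact: cu|exact: cv]|exact: ca].
Qed.

Lemma is_derive_perturb (t k e lu lv : R) u v :
  is_derive t 1 u lu -> is_derive t 1 v lv ->
  is_derive t 1 (fun s => u s - v s + (k * s + e)) (lu - lv + k).
Proof.
move=> du dv; have da : is_derive t 1 (fun s : R => k * s + e) k.
  by apply: is_derive_eq; rewrite /GRing.scale/=; ring.
have duv : is_derive t 1 (u \- v) (lu - lv) by exact: is_deriveB.
exact: is_deriveD duv da.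
Qed.

Lemma ac_cst (a b k : R) : absolutely_continuous a b (cst k).
Proof. by apply: (ac_lipschitz a b _ 0) => s t _ _ _; rewrite subrr normr0 mul0r. Qed.

End affine_perturbation.

(** * Primitives of bounded functions with bounded support *)

Section primitive.
Context {R : realType}.
Local Notation mu := (@lebesgue_measure R).
Implicit Types (g : R -> R) (a b K : R).

(** Integrating from -oo rather than from the left end of the support defines the
primitive on the whole line, so that it is globally Lipschitz and differentiable
almost everywhere without side conditions. *)
Definition primitive g (x : R) : R := \int[mu]_(r in `]-oo, x]) g r.

Definition bounded_on_itv a b K g :=
  [/\ measurable_fun setT g, forall r, `|g r| <= K &
      forall r, ~~ (a <= r <= b) -> g r = 0].

Lemma bounded_on_itv_integrable a b K g (D : set R) :
  measurable D -> bounded_on_itv a b K g -> mu.-integrable D (EFin \o g).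
Proof.
move=> mD [mg gK g0]; apply: (@integrableS _ _ _ _ setT) => //.
rewrite (_ : EFin \o g = (EFin \o g) \_ `[a, b]%classic); last first.
  apply/funext => r /=; rewrite patchE; case: ifPn => //.
  by rewrite notin_setE /= in_itv/= => /negP /g0 ->.
apply/(integrable_mkcond _ _).1 => //.
apply: measurable_bounded_integrable => //.
- by rewrite /= lebesgue_measure_itv/=; case: ifP => _; rewrite ?ltry// -EFinB ltry.
- exact: measurable_funTS.
- by exists `|K|; split; [exact: num_real|] => M KM r _ /=;
    apply: le_trans (gK r) _; apply: le_trans (ler_norm K) (ltW KM).
Qed.

Lemma primitiveB a b K g s t : bounded_on_itv a b K g -> s <= t ->
  primitive g t - primitive g s = \int[mu]_(r in `]s, t]) g r.
Proof.
by move=> bg st; apply: Rintegral_itvB => //; exact: bounded_on_itv_integrable bg.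
Qed.

Lemma primitive_dist a b K K' e g g' s t :
  bounded_on_itv a b K g -> bounded_on_itv a b K' g' -> s <= t ->
  (forall r, s < r <= t -> `|g r - g' r| <= e) ->
  `|(primitive g t - primitive g s) - (primitive g' t - primitive g' s)|
    <= e * (t - s).
Proof.
move=> bg bg' st ge; rewrite (primitiveB a b K g s t bg st) (primitiveB a b K' g' s t bg' st).
have ig : mu.-integrable `]s, t] (EFin \o g) by exact: bounded_on_itv_integrable bg.
have ig' : mu.-integrable `]s, t] (EFin \o g') by exact: bounded_on_itv_integrable bg'.
rewrite -RintegralB//.
have igg : mu.-integrable `]s, t] (EFin \o (fun r => g r - g' r)).
  by have := integrableB _ ig ig'; apply.
apply: le_trans (le_normr_Rintegral _ igg) _ => //.
have -> : e * (t - s) = \int[mu]_(r in `]s, t]) e.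
  have mst : mu `]s, t]%classic = (t - s)%:E.
    apply: etrans (lebesgue_measure_itv _) _; rewrite /= lte_fin.
    by case: ltP st => [//|ts st]; rewrite (_ : t = s) ?subrr//; lra.
  by rewrite Rintegral_cst//; congr (e * _); exact: (congr1 fine (esym mst)).
apply: le_Rintegral => //.
- have := integrable_norm igg; apply.
- apply: measurable_bounded_integrable => //.
  + by rewrite /= lebesgue_measure_itv/=; case: ifP => _; rewrite ?ltry// -EFinB ltry.
  + by exists `|e|; split; [exact: num_real|] => M KM r _ /=; apply: ltW KM.
Qed.

Lemma primitive_lipschitz a b K g s t : bounded_on_itv a b K g -> s <= t ->
  `|primitive g t - primitive g s| <= K * (t - s).
Proof.
move=> bg st; have [_ gK _] := bg.
have b0 : bounded_on_itv a b 0 (cst 0) by split => // r; rewrite normr0.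
have p0 x : primitive (cst 0) x = 0 by rewrite /primitive Rintegral_cst// mul0r.
have := primitive_dist _ _ _ _ K _ _ _ _ bg b0 st.
by rewrite !p0 subrr !subr0; apply => r _; rewrite subr0.
Qed.

Lemma primitive_derive a b K g : bounded_on_itv a b K g ->
  {ae mu, forall t : R, is_derive t 1 (primitive g) (g t)}.
Proof.
move=> bg.
have ig D : measurable D -> mu.-integrable D (EFin \o g).
  by move=> mD; exact: bounded_on_itv_integrable bg.
have lg : locally_integrable setT g.
  by apply: open_integrable_locally; [exact: openT|exact: ig].
have := FTC1Ny (fun y => ig `]-oo, y]%classic (measurable_itv _)) lg.
by apply: aeS => t [dg <-]; split; rewrite ?derive1E.
Qed.

End primitive.

(** * Existence for a backward Caratheodory problem *)

Section peano.
Context {R : realType}.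

(** Convergence along an ultrafilter replaces the extraction of a subsequence: one
ultrafilter serves all points t at once, with no diagonal argument. *)
Lemma ultra_bounded_cvg (G : set_system nat) (u : nat -> R) (M : R) :
  UltraFilter G -> (forall n, `|u n| <= M) -> exists l : R, u n @[n --> G] --> l.
Proof.
move=> UG uM; have PG : ProperFilter G by exact: ultra_proper.
have uI : (u n @[n --> G]) `[- M, M]%classic.
  by apply: nearW => n /=; rewrite in_itv/= -ler_norml.
have [l [_ ul]] := @segment_compact R (- M) M _ (fmap_proper_filter _ PG) uI.
exists l => U lU; have [//|GV] := in_ultra_setVsetC (u @^-1` U) UG.
have uGV : (u n @[n --> G]) (u @` (~` (u @^-1` U))).
  suff : \forall n \near G, (u @` (~` (u @^-1` U))) (u n) by [].
  by apply: filterS GV => n nU; exists n.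
by have [x [[n nU <-] /nU]] := ul _ _ uGV lU.
Qed.

Variables (a b A B Q : R) (alpha beta phi : R -> R).
Hypothesis ab : a <= b.
Hypothesis alphaP : bounded_on_itv a b A alpha.
Hypothesis betaP : bounded_on_itv a b B beta.
Hypothesis phiQ : forall x, `|phi x| <= Q.
Hypothesis phi_uniform : forall e, 0 < e -> exists2 d, 0 < d &
  forall x y, `|x - y| < d -> `|phi x - phi y| < e.

Let K := A * Q + B.
Let A_ge0 : 0 <= A.
Proof. by have [_ /(_ 0) h _] := alphaP; apply: le_trans h. Qed.
Let Q_ge0 : 0 <= Q. Proof. exact: le_trans (phiQ 0). Qed.
Let B_ge0 : 0 <= B.
Proof. by have [_ /(_ 0) h _] := betaP; apply: le_trans h. Qed.
Let K_ge0 : 0 <= K. Proof. by rewrite addr_ge0// mulr_ge0. Qed.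

Let lip (v : R -> R) := forall s t, s <= t -> `|v t - v s| <= K * (t - s).

(* The delay eta > 0 makes the equation explicit: the slope at r depends on the
   values of v at r + eta only. *)
Let field (eta : R) (v : R -> R) (r : R) := alpha r * phi (v (r + eta)) + beta r.

Let step (eta : R) (v : R -> R) (t : R) :=
  primitive (field eta v) b - primitive (field eta v) t.

Let lip_uniform e : 0 < e -> exists2 d, 0 < d &
  forall v, lip v -> forall s t, `|t - s| < d -> `|v t - v s| < e.
Proof.
move=> e0; exists (e / (K + 1)); first by rewrite divr_gt0// ltr_wpDl.
move=> v lv s t; wlog st : s t / s <= t => [hw|].
  by have [/hw//|/ltW/hw] := leP s t; rewrite distrC [`|v s - _|]distrC.
rewrite ger0_norm ?subr_ge0// ltr_pdivlMr ?ltr_wpDl// => tse.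
apply: le_lt_trans (lv _ _ st) _; apply: le_lt_trans tse.
by rewrite mulrC ler_wpM2l ?subr_ge0// lerDl.
Qed.

Let field_bounded eta v : lip v -> bounded_on_itv a b K (field eta v).
Proof.
move=> lv; have [ma aA a0] := alphaP; have [mb bB b0] := betaP; split.
- apply: measurable_funD => //; apply: measurable_funM => //.
  apply: continuous_measurable_fun => x; apply/cvgrPdist_lt => e e0.
  have [d d0 dP] := phi_uniform _ e0; have [r r0 rP] := lip_uniform _ d0.
  near=> y; apply/dP/(rP _ lv); rewrite opprD addrACA subrr addr0.
  by near: y; apply/nbhs_ballP; exists r.
- move=> r; apply: le_trans (ler_normD _ _) _; rewrite lerD// normrM.
  by apply: ler_pM.
- by move=> r rab; rewrite /field a0// b0// mul0r addr0.
Unshelve. all: by end_near. Qed.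

Let step_lip eta v : lip v -> lip (step eta v).
Proof.
move=> lv s t st; rewrite /step opprB addrC addrA subrK distrC.
exact: primitive_lipschitz (field_bounded eta v lv) st.
Qed.

Let step_ge eta v t : lip v -> b <= t -> step eta v t = 0.
Proof.
move=> lv bt; apply/eqP; rewrite subr_eq0 eq_sym -subr_eq0 -normr_le0.
have bf := field_bounded eta v lv; have [_ _ f0] := bf.
have z0 : bounded_on_itv a b 0 (cst 0) by split => // r; rewrite normr0.
have := primitive_dist a b K 0 0 _ _ b t bf z0 bt.
rewrite mul0r [X in _ - X](_ : _ = 0); last first.
  by rewrite /primitive !Rintegral_cst// !mul0r subrr.
rewrite subr0; apply => r /andP[br _].
by rewrite f0 ?subrr ?normr0//; apply/negP => /andP[_]; lra.
Qed.

Let step_local eta v w tau : lip v -> lip w -> (forall t, tau <= t -> v t = w t) ->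
  forall t, tau - eta <= t -> step eta v t = step eta w t.
Proof.
move=> lv lw vw t taut; have [bt|tb] := leP b t; first by rewrite !step_ge.
apply/eqP; rewrite -subr_eq0 -normr_le0 -[leRHS](mul0r (b - t)).
apply: (primitive_dist a b K K 0 _ _ t b) (ltW tb) _; [exact: field_bounded..|].
move=> r /andP[tr rb]; rewrite /field vw ?subrr ?normr0//; lra.
Qed.

Let delay (n : nat) := (b - a) / n.+1%:R.

(* n.+1 steps of length delay n cover [a, b], after which iterating no longer
   changes anything there. *)
Let approx n := iter n.+1 (step (delay n)) (cst 0).

Let iter_lip eta k : lip (iter k (step eta) (cst 0)).
Proof.
elim: k => [|k IH] /=; last exact: step_lip.
by move=> s t st; rewrite subrr normr0 mulr_ge0// subr_ge0.
Qed.

Let approx_fixed n t : a <= t -> step (delay n) (approx n) t = approx n t.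
Proof.
move=> at_; have h k : forall s, b - k%:R * delay n <= s ->
    iter k.+1 (step (delay n)) (cst 0) s = iter k (step (delay n)) (cst 0) s.
  elim: k => [|k IH] s.
    rewrite mul0r subr0 => bs; rewrite iterS step_ge//; exact: (iter_lip 0 0).
  rewrite -natr1 mulrDl mul1r opprD addrA => ks.
  change (step (delay n) (iter k.+1 (step (delay n)) (cst 0)) s =
          step (delay n) (iter k (step (delay n)) (cst 0)) s).
  by apply: step_local ks => //; exact: iter_lip.
apply: (h n.+1); rewrite /delay mulrCA divff ?mulr1//; lra.
Qed.

Let approx_bound n t : `|approx n t| <= K * `|b - t|.
Proof.
have an : approx n b = 0 by rewrite /approx iterS step_ge//; exact: iter_lip.
have [tb|/ltW bt] := leP t b.
  have := iter_lip (delay n) n.+1 t b tb; rewrite -/(approx n) an sub0r normrN.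
  by rewrite [`|b - t|]ger0_norm// subr_ge0.
have := iter_lip (delay n) n.+1 b t bt; rewrite -/(approx n) an subr0.
by rewrite [`|b - t|]distrC [`|t - b|]ger0_norm// subr_ge0.
Qed.

(** Tonelli's construction. The equations delayed by (b - a) / (n + 1) are solved
exactly on [a, b] by finitely many iterations, and their solutions are all
K-Lipschitz with value 0 at b. A pointwise limit y along an ultrafilter is again
K-Lipschitz, and equicontinuity makes the convergence uniform; as phi is uniformly
continuous, the delayed integrands then converge uniformly, and so y solves the
equation without delay. *)
Lemma peano_backward : exists y : R -> R,
  (forall s t, s <= t -> `|y t - y s| <= K * (t - s)) /\
  let g r := alpha r * phi (y r) + beta r in
  forall t, a <= t <= b -> y t = primitive g b - primitive g t.
Proof.
have [G [UG oG]] := @ultraFilterLemma nat \oo eventually_filter.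
have PG : ProperFilter G by exact: ultra_proper.
have [y yP] : exists y : R -> R, forall t, approx n t @[n --> G] --> y t.
  have [y yP] := choice (fun t => ultra_bounded_cvg G (approx^~ t) _ UG
                                    (approx_bound^~ t)).
  by exists y.
have near_y t e : 0 < e -> \forall n \near G, `|approx n t - y t| < e.
  move=> e0; have /cvgrPdist_lt/(_ e e0) := yP t.
  by apply: filterS => n; rewrite (distrC (y t)).
have lip_y : lip y.
  move=> s t st; apply/ler_addgt0Pr => e e0.
  have e2 : 0 < e / 2 by rewrite divr_gt0.
  have [n [ns nt]] : exists n, `|approx n s - y s| < e / 2 /\ `|approx n t - y t| < e / 2.
    have /filter_ex[n] : \forall n \near G, `|approx n s - y s| < e / 2 /\
        `|approx n t - y t| < e / 2.
      by near=> n; split; near: n; exact: near_y.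
    by exists n.
  have := iter_lip (delay n) n.+1 s t st; rewrite -/(approx n).
  move: ns nt; rewrite !ltr_norml !ler_norml.
  by move=> /andP[? ?] /andP[? ?] /andP[? ?]; apply/andP; split; lra.
(* uniform convergence on [a, x], extended to the right by real induction *)
have unif e : 0 < e -> \forall n \near G, forall t, a <= t <= b ->
    `|approx n t - y t| < e.
  move=> e0.
  apply: (real_induction a b (fun x => \forall n \near G, forall t, a <= t <= x ->
    `|approx n t - y t| < e) ab).
    have := near_y a e e0; apply: filterS => n na t /andP[at_ ta].
    by have -> : t = a by lra.
  move=> t /andP[at_ tb].
  have e4 : 0 < e / 4 by rewrite divr_gt0.
  exists (e / 4 / (K + 1)); first by rewrite divr_gt0// ltr_wpDl.
  move=> u v /andP[au ut] /andP[tv vb] ru rv.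
  have Kd s : u <= s <= v -> K * `|s - t| <= e / 4.
    move=> /andP[us sv]; apply: (@le_trans _ _ ((K + 1) * (e / 4 / (K + 1)))).
      by apply: ler_pM => //; rewrite ?lerDl// ler_norml; apply/andP; split; lra.
    by rewrite mulrC divfK// gt_eqF// ltr_wpDl.
  have lipd w s : lip w -> u <= s <= v -> `|w s - w t| <= e / 4.
    move=> lw /Kd; apply: le_trans; have [st|/ltW ts] := leP s t.
      by rewrite distrC [`|s - t|]distrC [`|t - s|]ger0_norm ?subr_ge0// lw.
    by rewrite [`|s - t|]ger0_norm ?subr_ge0// lw.
  have := near_y t _ e4; apply: filterS2 => n nt nu s /andP[as_ sv].
  have [su|us] := leP s u; first by apply: nu; rewrite as_.
  have suv : u <= s <= v by rewrite ltW.
  have := lipd y s lip_y suv; have := lipd _ s (iter_lip (delay n) n.+1) suv.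
  rewrite -/(approx n); move: nt; rewrite !ltr_norml !ler_norml.
  by move=> /andP[? ?] /andP[? ?] /andP[? ?]; apply/andP; split; lra.
exists y; split=> // g t /andP[at_ tb].
have gE : g = field 0 y by apply/funext => r; rewrite /g /field addr0.
rewrite gE -/(step 0 y t).
apply/eqP; rewrite -subr_eq0 -normr_le0; apply/ler_addgt0Pr => e' e'0; rewrite add0r.
(* chosen so that e + A e (b - a) = e' *)
pose e := e' / (1 + A * (b - a)).
have c0 : 0 < 1 + A * (b - a) by rewrite ltr_pwDl// mulr_ge0// subr_ge0.
have e0 : 0 < e by rewrite divr_gt0.
have [d d0 dP] := phi_uniform e e0.
have d2 : 0 < d / 2 by rewrite divr_gt0.
have [r r0 rP] := lip_uniform _ d2.
have [n [n1 n2 n3]] : exists n, [/\ delay n < r,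
    forall s, a <= s <= b -> `|approx n s - y s| < d / 2 &
    `|approx n t - y t| < e].
  have r1 : 0 < r / (b - a + 1) by rewrite divr_gt0//; lra.
  have dr : \forall n \near G, delay n < r.
    have := near_infty_natSinv_lt (PosNum r1) => /oG; apply: filterS => n /= nr.
    apply: (@le_lt_trans _ _ ((b - a + 1) * n.+1%:R^-1)).
      by rewrite /delay ler_wpM2r ?invr_ge0//; lra.
    by rewrite mulrC -ltr_pdivlMr//; lra.
  have /filter_ex[n [? ? ?]] : \forall n \near G, [/\ delay n < r,
      forall s, a <= s <= b -> `|approx n s - y s| < d / 2 &
      `|approx n t - y t| < e].
    by near=> n; split; near: n; [exact: dr|exact: unif|exact: near_y].
  by exists n.
have lA : lip (approx n) by exact: iter_lip.
have h1 : `|approx n t - step 0 y t| <= A * e * (b - t).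
  rewrite -approx_fixed//.
  apply: (primitive_dist a b K K (A * e) _ _ t b) tb _; [exact: field_bounded..|].
  move=> s /andP[ts sb]; rewrite /field opprD addrACA subrr addr0 -mulrBr normrM.
  have [_ aA _] := alphaP; apply: ler_pM => //; apply/ltW/dP; rewrite addr0.
  have dn : 0 <= delay n by rewrite /delay divr_ge0// subr_ge0.
  have : `|approx n (s + delay n) - approx n s| < d / 2.
    by apply: (rP _ lA); rewrite addrC addKr ger0_norm.
  have : `|approx n s - y s| < d / 2 by apply: n2; apply/andP; split; lra.
  by rewrite !ltr_norml => /andP[? ?] /andP[? ?]; apply/andP; split; lra.
have h2 : A * e * (b - t) <= A * e * (b - a).
  by apply: ler_wpM2l; [rewrite mulr_ge0// ltW|lra].
have e'E : e * (1 + A * (b - a)) = e' by rewrite /e divfK// gt_eqF.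
move: h1 n3; rewrite !ler_norml !ltr_norml => /andP[? ?] /andP[? ?].
by apply/andP; split; lra.
Unshelve. all: by end_near. Qed.

End peano.

(** * Conjugate exponents, semicontinuity and measurability *)

Section data.
Context {R : realType}.
Local Notation mu := (@lebesgue_measure R).

Lemma conj_exponentE (p : R) : 1 < p ->
  [/\ 1 < conj_exponent p, (conj_exponent p)^-1 = 1 - p^-1 &
      conj_exponent p - 1 = conj_exponent p * p^-1].
Proof.
move=> p1; rewrite /conj_exponent.
have p0 : p != 0 by rewrite gt_eqF//; lra.
have p10 : p - 1 != 0 by rewrite gt_eqF//; lra.
split; last 2 first.
- by rewrite invf_div; field.
- by field; rewrite p0 p10.
- by rewrite ltr_pdivlMr; lra.
Qed.

Definition restrict_oo (a b : R) (f : R -> R) r := if a < r < b then f r else 0.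

Lemma lsc_nbhs (a b : R) (f : R -> R) (t l : R) :
  lower_semicontinuous_on `]a, b[ f -> a < t < b -> l < f t ->
  exists2 r, 0 < r & forall s, `|s - t| < r -> a < s < b /\ l < f s.
Proof.
move=> flsc tab lt; have [V tV VP] := flsc t l lt.
have abt : nbhs t `]a, b[%classic.
  by apply: open_nbhs_nbhs; split; [exact: interval_open|rewrite /= in_itv].
have {}tV : \forall s \near t, `]a, b[%classic s -> V s.
  have tA : `]a, b[%classic t by rewrite /= in_itv.
  by move: tV; case: (@nbhs_subspaceP _ `]a, b[%classic t).
have /nbhs_ballP[r /= r0 rP] : \forall s \near t,
    `]a, b[%classic s /\ (`]a, b[%classic s -> V s) by exact: filterI.
exists r => // s st.
have [|sab sV] := rP s; first by rewrite /ball/= distrC.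
split; first by move: sab; rewrite /= in_itv.
by have := VP s (sV sab); rewrite lte_fin.
Qed.

(** Extending f by 0 preserves lower semicontinuity, because f is positive and
]a, b[ is open. *)
Lemma lsc_measurable (a b : R) (f : R -> R) :
  lower_semicontinuous_on `]a, b[ f -> {in `]a, b[, forall t, 0 < f t} ->
  measurable_fun setT (restrict_oo a b f).
Proof.
move=> flsc f0; apply/measurable_EFinP.
apply: (@lower_semicontinuous_measurable R (EFin \o restrict_oo a b f)).
move=> t l lt; have {lt} : l < restrict_oo a b f t by exact: lt.
rewrite /restrict_oo; case: ifPn => [tab lt|tab l0].
  have [r r0 rP] := lsc_nbhs a b f t l flsc tab lt.
  exists (ball t r); first exact: nbhsx_ballx.
  move=> s; rewrite /ball/= distrC => /rP[sab ls].
  by rewrite lte_fin sab.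
exists setT; first exact: filterT.
move=> s _; rewrite lte_fin; case: ifPn => [sab|//].
by apply: lt_trans l0 _; apply: f0; rewrite in_itv.
Qed.

Lemma piecewise_continuous01_measurable (h : R -> R) :
  piecewise_continuous01 h -> measurable_fun (`[0, 1]%classic : set R) h.
Proof.
move=> [q [k [k0 k1 klt _ kc]]].
have k_ge0 j : (j <= q.+1)%N -> 0 <= k j.
  elim: j => [|j IH] jq; first by rewrite k0.
  by apply: le_trans (IH (ltnW jq)) _; apply/ltW/klt.
suff H j : (j <= q.+1)%N -> measurable_fun (`[0, k j]%classic : set R) h by rewrite -k1; exact: H.
elim: j => [_|j IH jq].
  by rewrite k0 set_itv1; exact: measurable_fun_set1.
have kj : k j < k j.+1 by exact: klt.
have k0j : 0 <= k j by apply: k_ge0; exact: ltnW.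
have -> : `[0, k j.+1]%classic =
    (`[0, k j] `|` `]k j, k j.+1[) `|` [set k j.+1] :> set R.
  apply/seteqP; split=> x /=; rewrite !in_itv/=.
    move=> /andP[x0 x1]; have [xk|kx] := leP x (k j); first by left; left; rewrite x0.
    move: x1; rewrite le_eqVlt => /predU1P[->|x1]; first by right.
    by left; right.
  move=> [[/andP[x0 xk]|/andP[kx xk]]|->]; apply/andP; split; lra.
apply/measurable_funU => //; first exact: measurableU.
split; last exact: measurable_fun_set1.
apply/measurable_funU => //; split; first by apply: IH; exact: ltnW.
apply: open_continuous_measurable_fun; first exact: interval_open.
by move=> x; rewrite inE => xk; exact: (kc j jq x).
Qed.

End data.

(** * Solutions issued backward from (1, 0) *)

Section backward_problem.
Context {R : realType}.
Local Notation mu := (@lebesgue_measure R).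

Variables (p m C0 : R) (f h : R -> R).
Hypothesis p_gt1 : 1 < p.
Hypothesis f_gt0 : {in `]0, 1[, forall t, 0 < f t}.
Hypothesis f_lsc : lower_semicontinuous_on `]0, 1[ f.
Hypothesis m_gt0 : 0 < m.
Hypothesis f_le :
  {in `]0, 1[, forall t, f t <= m * t `^ (conj_exponent p - 1)}.
Hypothesis h_meas : measurable_fun (`[0, 1]%classic : set R) h.
Hypothesis h_le : forall t, 0 <= t <= 1 -> `|h t| <= C0.

Local Notation q := p^-1.
Local Notation p' := (conj_exponent p).

Let q01 : 0 < q <= 1.
Proof.
have p0 : 0 < p by apply: lt_trans p_gt1.
by rewrite invr_gt0 p0 invf_le1// ltW.
Qed.

Let p'_gt1 : 1 < p'. Proof. by have [] := conj_exponentE p p_gt1. Qed.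

Let p'_gt0 : 0 < p'. Proof. exact: lt_trans p'_gt1. Qed.

Definition caratheodory_solution (c : R) (y : R -> R) : Prop :=
  absolutely_continuous 0 1 y /\
  {ae mu, forall t : R, t \in `]0, 1[ ->
     is_derive t 1 y (p' * ((c - h t) * pos_part (y t) `^ q - f t))}.

Let f_le_m t : 0 < t < 1 -> f t <= m.
Proof.
move=> /[dup] t01 /andP[t0 t1]; apply: le_trans (f_le t _) _; first by rewrite in_itv.
rewrite ler_piMr ?(ltW m_gt0)// -[leRHS](powRr0 t).
by apply: ger_powR; [rewrite t0 ltW|rewrite subr_ge0 ltW].
Qed.

Let C (c : R) : R := `|c| + C0 + 1.

Let C_gt0 c : 0 < C c.
Proof.
have C0_ge0 : 0 <= C0 by apply: le_trans (h_le 0 _); rewrite ?lexx ?ler01.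
by rewrite /C; have := normr_ge0 c; lra.
Qed.

Let h_leC c t : 0 <= t <= 1 -> `|h t - c| <= C c.
Proof. by move=> /h_le ht; apply: le_trans (ler_normB _ _) _; rewrite /C; lra. Qed.

(** The root is not bounded, so it is cut off at height Q. With the constant k
below and M = k^p', every solution of the cut-off equation has slope at most
p' (C Q + m) <= M in absolute value, where Q = k^(p' - 1) = M^(1/p); it therefore
stays below M on [0, 1], where the cut-off is not felt. *)
Lemma caratheodory_solution_exists c :
  exists2 y, caratheodory_solution c y & y 1 = 0.
Proof.
pose k := 1 + p' * (C c + m).
have Cm : 0 < C c + m by exact: addr_gt0 (C_gt0 c) m_gt0.
have k1 : 1 <= k by rewrite /k lerDl ltW// mulr_gt0.
have k_gt0 : 0 < k by apply: lt_le_trans k1.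
pose Q := k `^ (p' - 1).
have Q1 : 1 <= Q.
  by rewrite /Q -[X in X <= _](powRr0 k) ler_powR// subr_ge0 ltW.
pose A := p' * C c; pose B := p' * m.
have KQ : posroot q (A * Q + B) <= Q.
  have QE : Q = posroot q (k `^ p').
    rewrite /posroot pos_part_id ?powR_ge0// -powRrM.
    by have [_ _ <-] := conj_exponentE p p_gt1.
  rewrite [leRHS]QE; apply: posroot_homo; first by have /andP[/ltW] := q01.
  have -> : k `^ p' = k * Q by rewrite /Q mulr_powRB1// ltW.
  apply: (@le_trans _ _ (p' * (C c + m) * Q)).
    have -> : p' * (C c + m) * Q = A * Q + B * Q by rewrite /A /B; ring.
    by rewrite lerD2l ler_peMr// mulr_ge0 ?ltW.
  by apply: ler_wpM2r; [exact: le_trans Q1|rewrite /k lerDr].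
pose alpha r := if 0 <= r <= 1 then p' * (h r - c) else 0.
pose beta r := p' * restrict_oo 0 1 f r.
pose phi x := Num.min (posroot q x) Q.
have alphaP : bounded_on_itv 0 1 A alpha.
  split.
  - have -> : alpha = (fun r => p' * (h r - c)) \_ `[0, 1]%classic.
      apply/funext => r; rewrite patchE /alpha; case: ifPn => r01.
        by rewrite mem_set//= in_itv.
      by rewrite memNset//= in_itv; exact/negP.
    apply/(measurable_restrictT _ _).1 => //.
    by apply: measurable_funM => //; apply: measurable_funB.
  - move=> r; rewrite /alpha; case: ifPn => [r01|_]; last first.
      by rewrite normr0 /A mulr_ge0 ?ltW ?C_gt0.
    by rewrite normrM (ger0_norm (ltW p'_gt0)) /A; apply: ler_wpM2l; [exact: ltW|exact: h_leC].
  - by move=> r /negbTE r01; rewrite /alpha r01.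
have betaP : bounded_on_itv 0 1 B beta.
  split.
  - by apply: measurable_funM => //; exact: lsc_measurable.
  - move=> r; rewrite /beta normrM (ger0_norm (ltW p'_gt0)) /B.
    apply: ler_wpM2l; first exact: ltW.
    rewrite /restrict_oo; case: ifPn => r01; last by rewrite normr0 ltW.
    by rewrite ger0_norm ?f_le_m// ltW// f_gt0// in_itv.
  - move=> r /negP r01; rewrite /beta /restrict_oo ifF ?mulr0//.
    by apply/negP => /andP[? ?]; apply: r01; rewrite !ltW.
have Q_ge0 : 0 <= Q by exact: le_trans Q1.
have phi_ge0 x : 0 <= phi x by rewrite /phi le_min posroot_ge0.
have phiQ x : `|phi x| <= Q by rewrite ger0_norm// /phi ge_min lexx orbT.
have phi_uniform e : 0 < e -> exists2 d, 0 < d &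
    forall x y, `|x - y| < d -> `|phi x - phi y| < e.
  move=> e0; have [d d0 dP] := posroot_uniform q e q01 e0; exists d => // x y xy.
  apply: le_lt_trans (dP _ _ xy).
  rewrite /phi; case: (leP (posroot q x) Q) => hx; case: (leP (posroot q y) Q) => hy.
  - by [].
  - by rewrite !ler0_norm; lra.
  - by rewrite !ger0_norm; lra.
  - by rewrite subrr normr0.
have [y []] := peano_backward 0 1 A B Q alpha beta phi ler01 alphaP betaP phiQ phi_uniform.
set K := A * Q + B => ylip.
have K_ge0 : 0 <= K.
  have A0 : 0 <= A by rewrite mulr_ge0 ?ltW ?C_gt0.
  have B0 : 0 <= B by rewrite mulr_ge0// ltW.
  by rewrite addr_ge0// mulr_ge0.
pose g r := alpha r * phi (y r) + beta r; rewrite -/g => yE.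
have y1 : y 1 = 0 by rewrite yE ?subrr// ler01 lexx.
have phiE t : 0 <= t <= 1 -> phi (y t) = posroot q (y t).
  move=> /andP[t0 t1]; apply/min_idPl; apply: le_trans KQ.
  apply: posroot_homo; first by have /andP[/ltW] := q01.
  have := ylip t 1 t1; rewrite y1 sub0r normrN => yt.
  apply: le_trans (ler_norm _) _; apply: le_trans yt _.
  by rewrite ler_piMr//; lra.
have gb : bounded_on_itv 0 1 K g.
  have [ma aA a0] := alphaP; have [mb bB b0] := betaP; split.
  - apply: measurable_funD => //; apply: measurable_funM => //.
    apply: continuous_measurable_fun => x; apply/cvgrPdist_lt => e e0.
    have [d d0 dP] := phi_uniform _ e0.
    have K1 : 0 < K + 1 by rewrite ltr_wpDl.
    near=> z; apply: dP.
    have xz : `|x - z| < d / (K + 1).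
      by near: z; apply/nbhs_ballP; exists (d / (K + 1)) => //=; rewrite divr_gt0.
    apply: (@le_lt_trans _ _ (K * `|x - z|)).
      have [xz'|/ltW xz'] := leP z x; first by rewrite [`|x - z|]ger0_norm ?ylip ?subr_ge0.
      by rewrite distrC [`|x - z|]distrC [`|z - x|]ger0_norm ?ylip ?subr_ge0.
    move: xz; rewrite ltr_pdivlMr//; apply: le_lt_trans.
    by rewrite mulrC ler_wpM2l// lerDl.
  - move=> r; apply: le_trans (ler_normD _ _) _; rewrite lerD// normrM.
    by apply: ler_pM.
  - by move=> r r01; rewrite /g a0// b0// mul0r addr0.
have acy : absolutely_continuous 0 1 y.
  by apply: (ac_lipschitz 0 1 y K) => s t _ st _; exact: ylip.
have dy : {ae mu, forall t : R, t \in `]0, 1[ -> is_derive t 1 y (- g t)}.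
  apply: aeS (primitive_derive 0 1 K g gb) => t dt; rewrite in_itv/= => /andP[t0 t1].
  have {dt} dt : is_derive t 1 (fun s => primitive g 1 - primitive g s) (- g t).
    by apply: is_derive_eq; rewrite add0r mul1r.
  apply: near_eq_is_derive dt; near=> s; rewrite yE//; apply/andP; split.
    by apply/ltW; near: s; exact: lt_nbhsr.
  by apply/ltW; near: s; exact: lt_nbhsl.
have gE t : 0 < t < 1 -> g t = p' * ((h t - c) * posroot q (y t) + f t).
  move=> t01; have t01' : 0 <= t <= 1 by have /andP[? ?] := t01; rewrite !ltW.
  by rewrite /g /alpha /beta /restrict_oo t01 t01' phiE//; ring.
exists y => //; split => //.
apply: aeS dy => t dt t01; have := dt t01; rewrite gE; last by move: t01; rewrite in_itv.
by congr (is_derive _ _ _ _); rewrite /posroot; ring.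
Unshelve. all: by end_near. Qed.

Section sign.
Variables (c : R) (y : R -> R).
Hypotheses (yP : caratheodory_solution c y) (y1 : y 1 = 0).

(** While y < 0 the root vanishes, so that (- y)' = p' f >= 0 and backward
comparison applies to - y. *)
Lemma caratheodory_solution_ge0 t : 0 <= t <= 1 -> 0 <= y t.
Proof.
have [acy dy] := yP.
suff H : forall s, 0 <= s <= 1 -> (\- y) s <= 0 by move=> /H; rewrite /= oppr_le0.
apply: backward_comparison.
- by move=> x; apply: continuousN; exact: (ac_continuous _ _ _ acy).
- by move=> s u s0 su u1; apply: acN; apply: ac_sub acy; exact: ltW.
- apply: aeS dy => s ds s01; rewrite oppr_gt0 => ys.
  exists (p' * f s); first by rewrite mulr_ge0 ?ltW ?f_gt0.
  have {}ds := is_deriveN (ds s01); apply: is_derive_eq.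
  rewrite (_ : pos_part _ = 0); last by apply/max_idPr; exact: ltW.
  rewrite powR0; last by rewrite gt_eqF//; have /andP[] := q01.
  by ring.
- by rewrite /= y1 oppr0.
Qed.

(** Semicontinuity keeps f above some delta > 0 near an interior point t0. If
y t0 = 0, the root term is at most delta / 2 on a short interval after t0 by
continuity, so y' <= - p' delta / 2 there and y becomes negative. *)
Lemma caratheodory_solution_gt0 : {in `]0, 1[, forall t, 0 < y t}.
Proof.
have [acy dy] := yP.
move=> t0 /[dup] t01; rewrite in_itv/= => /[dup] t01' /andP[t00 t0_1].
rewrite lt_neqAle caratheodory_solution_ge0 ?ltW// andbT; apply/negP => /eqP yt0.
pose delta := f t0 / 2.
have delta0 : 0 < delta by rewrite divr_gt0// f_gt0.
have delta_f : delta < f t0 by have := f_gt0 _ t01; rewrite /delta; lra.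
have [r1 r10 r1P] := lsc_nbhs 0 1 f t0 delta f_lsc t01' delta_f.
have e0 : 0 < delta / 2 / C c by apply: divr_gt0 (C_gt0 c); rewrite divr_gt0.
have [d d0 dP] := posroot_uniform q _ q01 e0.
have [|r2 r20 r2P] := within_continuous_dist 0 1 y t0 d (ac_continuous _ _ _ acy) _ d0.
  by rewrite !ltW.
pose r := Num.min r1 r2 / 2.
have r0 : 0 < r by rewrite divr_gt0// lt_min r10.
have r120 : 0 < Num.min r1 r2 by rewrite lt_min r10.
have rr1 : r < r1.
  have ? : Num.min r1 r2 <= r1 by rewrite ge_min lexx.
  by rewrite /r; lra.
have rr2 : r < r2.
  have ? : Num.min r1 r2 <= r2 by rewrite ge_min lexx orbT.
  by rewrite /r; lra.
have nearP s : t0 <= s <= t0 + r -> [/\ 0 < s < 1, delta < f s &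
    `|(c - h s) * posroot q (y s)| <= delta / 2].
  move=> /andP[s1 s2]; have st0 : `|s - t0| <= r by rewrite ger0_norm ?subr_ge0//; lra.
  have [s01 fs] := r1P s (le_lt_trans st0 rr1).
  have s01' : 0 <= s <= 1 by have /andP[? ?] := s01; rewrite !ltW.
  split => //; rewrite normrM distrC.
  have := dP _ _ (r2P s s01' (le_lt_trans st0 rr2)).
  rewrite -yt0 [X in _ - X](_ : _ = 0); last first.
    rewrite /posroot pos_part_id// powR0// gt_eqF//; by have /andP[] := q01.
  rewrite subr0 => ps.
  have -> : delta / 2 = C c * (delta / 2 / C c).
    by rewrite [RHS]mulrC divfK// gt_eqF// C_gt0.
  by apply: ler_pM => //; [exact: h_leC|exact: ltW].
pose k := p' * (delta / 2).
have r1' : t0 + r < 1.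
  have [|/andP[_ //]] := nearP (t0 + r).
  by rewrite lexx andbT lerDl ltW.
have : 0 - y t0 + (- k * t0 + 0) <= 0 - y (t0 + r) + (- k * (t0 + r) + 0).
  apply: (ac_nondecreasing t0 (t0 + r) (fun s => 0 - y s + (- k * s + 0))).
  - by rewrite lerDl ltW.
  - by apply: ac_perturb; [exact: (ac_cst _ _ 0)|apply: ac_sub acy; exact: ltW].
  - apply: aeS dy => s ds; rewrite in_itv/= => /andP[s1 s2].
    have [s01 fs hs] : [/\ 0 < s < 1, delta < f s &
        `|(c - h s) * posroot q (y s)| <= delta / 2] by apply: nearP; rewrite !ltW.
    eexists; last by apply: is_derive_perturb; apply: ds; rewrite in_itv.
    rewrite -/(posroot q (y s)) sub0r -mulrN -/k /k -mulrBr mulr_ge0 ?ltW//.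
    by move: hs; rewrite ler_norml => /andP[? ?]; lra.
have : 0 <= y (t0 + r) by apply: caratheodory_solution_ge0; apply/andP; split; lra.
have : 0 < k * r by rewrite mulr_gt0// /k mulr_gt0// divr_gt0.
lra.
Qed.

End sign.
End backward_problem.

(** * Comparison in the desingularized variable *)

Section comparison.
Context {R : realType}.
Local Notation mu := (@lebesgue_measure R).

Variables (p : R) (f h : R -> R).
Hypothesis p_gt1 : 1 < p.
Hypothesis f_gt0 : {in `]0, 1[, forall t, 0 < f t}.

Local Notation q := p^-1.
Local Notation p' := (conj_exponent p).
Local Notation q' := (conj_exponent p)^-1.

Let p'_gt1 : 1 < p'. Proof. by have [] := conj_exponentE p p_gt1. Qed.

Let p'_gt0 : 0 < p'. Proof. exact: lt_trans p'_gt1. Qed.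

Let q'E : q' = 1 - q. Proof. by have [] := conj_exponentE p p_gt1. Qed.

Let q_gt0 : 0 < q. Proof. by rewrite invr_gt0 (lt_trans _ p_gt1). Qed.

Let q'01 : 0 < q' <= 1.
Proof. by rewrite invr_gt0 invf_le1 ?p'_gt0//= ltW. Qed.

(** The terminal condition alone is imposed, with no value prescribed at 0: one
such function exists for every speed c, and the boundary value problem is the
question whether it vanishes at 0. *)
Definition terminal_solution (c : R) (y : R -> R) : Prop :=
  [/\ caratheodory_solution p f h c y, y 1 = 0, 0 <= y 0 &
      {in `]0, 1[, forall t, 0 < y t}].

(** The unknown w = y^(1/p'), in which the equation is singular at 0 but monotone. *)
Definition desingularize (y : R -> R) : R -> R := posroot q' \o y.

Section one_solution.
Variables (c : R) (y : R -> R).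
Hypothesis yP : terminal_solution c y.

(** Since 1/p' - 1 = - 1/p, the factor y^(- 1/p) of the chain rule cancels the root
in the equation and leaves a right-hand side that increases with y. *)
Lemma desingularize_derive : {ae mu, forall t : R, t \in `]0, 1[ ->
  is_derive t 1 (desingularize y) (c - h t - f t / y t `^ q)}.
Proof.
have [[_ dy] _ _ ypos] := yP.
apply: aeS dy => t dy t01; have yt := ypos t t01.
apply: is_derive_eq (is_derive_posroot q' _ _ _ yt (dy t01)) _.
rewrite pos_part_id ?ltW//.
have -> : q' - 1 = - q by rewrite q'E; ring.
rewrite powRN; have := powR_gt0 q yt; move: (y t `^ q) => Y Y0.
by field; rewrite !gt_eqF// p'_gt0.
Qed.

(** A positive continuous function is bounded away from 0 on [s, t], where the power
is then Lipschitz. *)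
Lemma desingularize_ac s t : 0 < s -> s <= t -> t < 1 ->
  absolutely_continuous s t (desingularize y).
Proof.
move=> s0 st t1; have [[acy _] _ _ ypos] := yP.
have acst : absolutely_continuous s t y by apply: ac_sub acy; exact: ltW.
have [z zst zmin] := EVT_min st (ac_continuous _ _ _ acst).
have yz : 0 < y z.
  by apply: ypos; move: zst; rewrite !in_itv/= => /andP[? ?]; apply/andP; split; lra.
apply: (ac_comp_lipschitz _ _ y (posroot q') (y z `^ (q' - 1)) acst) => u v su sv.
by apply: posroot_lipschitz => //; apply: zmin; rewrite in_itv.
Qed.

Lemma desingularize_continuous : {within `[0, 1], continuous (desingularize y)}.
Proof.
have [[acy _] _ _ _] := yP; apply/subspace_continuousP => t t01.
have /subspace_continuousP/(_ t t01) yc := ac_continuous _ _ _ acy.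
exact: (cvg_comp _ _ yc (posroot_continuous q' q'01 (y t))).
Qed.

Lemma desingularize1 : desingularize y 1 = 0.
Proof.
have [_ y1 _ _] := yP; rewrite /desingularize/= y1 /posroot pos_part_id//.
by rewrite powR0// gt_eqF// invr_gt0.
Qed.

Lemma desingularize_ge0 t : 0 <= desingularize y t.
Proof. exact: posroot_ge0. Qed.

End one_solution.

Lemma desingularize_eq0 y t : 0 <= y t -> (desingularize y t == 0) = (y t == 0).
Proof.
move=> yt; rewrite /desingularize/= /posroot pos_part_id// powR_eq0.
by rewrite (gt_eqF (_ : 0 < q')) ?invr_gt0// andbT.
Qed.

Lemma desingularize_inj y z t : 0 <= y t -> 0 <= z t ->
  desingularize y t = desingularize z t -> y t = z t.
Proof.
move=> yt zt; rewrite /desingularize/= /posroot !pos_part_id//.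
by apply: powR_injective; rewrite ?invr_gt0// nnegrE.
Qed.

Let desingularize_lt y z t : desingularize y t < desingularize z t -> y t < z t.
Proof.
move=> yz; rewrite ltNge; apply/negP => zy; move: yz; rewrite ltNge.
by rewrite posroot_homo// ltW//; have /andP[] := q'01.
Qed.

(* The monotonicity on which every comparison of solutions rests; this is where
   the sign of f matters. *)
Let singular_homo s a b : s \in `]0, 1[ -> 0 < a -> a <= b ->
  f s / b `^ q <= f s / a `^ q.
Proof.
move=> s01 a0 ab; apply: ler_wpM2l; first by apply/ltW/f_gt0.
rewrite lef_pV2 ?posrE ?powR_gt0//; last exact: lt_le_trans ab.
by apply: ge0_ler_powR; rewrite ?nnegrE ?(ltW q_gt0)// ltW// (lt_le_trans a0).
Qed.

(** Where w2 > w1 one has y2 > y1, so w2' - w1' >= c2 - c1 >= 0, whereas w2 and w1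
agree at 1. *)
Lemma desingularize_nonincreasing c1 c2 y1 y2 : c1 <= c2 ->
  terminal_solution c1 y1 -> terminal_solution c2 y2 ->
  forall t, 0 <= t <= 1 -> desingularize y2 t <= desingularize y1 t.
Proof.
move=> c12 y1P y2P t t01.
have := backward_comparison 0 1
  (fun s => desingularize y2 s - desingularize y1 s + (0 * s + 0)).
move=> /(_ _ _ _ _ t t01) H.
have {H} : desingularize y2 t - desingularize y1 t + (0 * t + 0) <= 0; last lra.
apply: H.
- exact: within_continuous_perturb (desingularize_continuous _ _ y2P)
    (desingularize_continuous _ _ y1P).
- move=> s u s0 su u1.
  exact: ac_perturb (desingularize_ac _ _ y2P _ _ s0 su u1)
    (desingularize_ac _ _ y1P _ _ s0 su u1).
- apply: aeS2 (desingularize_derive _ _ y1P) (desingularize_derive _ _ y2P).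
  move=> s d1 d2 s01; rewrite mul0r !addr0 subr_gt0 => /desingularize_lt/ltW yy.
  eexists; last exact: is_derive_perturb (d2 s01) (d1 s01).
  have [_ _ _ /(_ s s01) y1s] := y1P.
  by have := singular_homo s _ _ s01 y1s yy; lra.
- by rewrite (desingularize1 _ _ y1P) (desingularize1 _ _ y2P); lra.
Qed.

(** Backward comparison applied to w1 - w2 - (c2 - c1) (1 - t): while this is
positive, w1 > w2 and the singular terms push w1 - w2 upward, so its derivative is
at least (c1 - c2) + (c2 - c1) = 0. *)
Lemma desingularize_lipschitz c1 c2 y1 y2 : c1 <= c2 ->
  terminal_solution c1 y1 -> terminal_solution c2 y2 ->
  forall t, 0 <= t <= 1 ->
    desingularize y1 t <= desingularize y2 t + (c2 - c1) * (1 - t).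
Proof.
move=> c12 y1P y2P t t01.
have := backward_comparison 0 1 (fun s => desingularize y1 s - desingularize y2 s
  + ((c2 - c1) * s + - (c2 - c1))).
move=> /(_ _ _ _ _ t t01) H.
have {H} : desingularize y1 t - desingularize y2 t
    + ((c2 - c1) * t + - (c2 - c1)) <= 0; last lra.
apply: H.
- exact: within_continuous_perturb (desingularize_continuous _ _ y1P)
    (desingularize_continuous _ _ y2P).
- move=> s u s0 su u1.
  exact: ac_perturb (desingularize_ac _ _ y1P _ _ s0 su u1)
    (desingularize_ac _ _ y2P _ _ s0 su u1).
- apply: aeS2 (desingularize_derive _ _ y1P) (desingularize_derive _ _ y2P).
  move=> s d1 d2 s01 ds.
  have /desingularize_lt/ltW yy : desingularize y2 s < desingularize y1 s.
    have : 0 <= (c2 - c1) * (1 - s).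
      by apply: mulr_ge0; [lra|move: s01; rewrite in_itv/= => /andP[? ?]; lra].
    lra.
  eexists; last exact: is_derive_perturb (d1 s01) (d2 s01).
  have [_ _ _ /(_ s s01) y2s] := y2P.
  by have := singular_homo s _ _ s01 y2s yy; lra.
- by rewrite (desingularize1 _ _ y1P) (desingularize1 _ _ y2P); lra.
Qed.

Lemma terminal_solution_unique c y z : terminal_solution c y ->
  terminal_solution c z -> {in `[0, 1], y =1 z}.
Proof.
have ge0 u t : terminal_solution c u -> 0 <= t <= 1 -> 0 <= u t.
  move=> [_ u1 u0 upos] /andP[].
  rewrite le_eqVlt => /predU1P[<-//|t0]; rewrite le_eqVlt => /predU1P[->|t1].
    by rewrite u1.
  by apply/ltW/upos; rewrite in_itv/= t0.
move=> yP zP t; rewrite in_itv/= => t01; apply: desingularize_inj; [exact: ge0..|].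
by apply/le_anti/andP; split; apply: (desingularize_nonincreasing c c).
Qed.

(** As f t <= m t^(p' - 1), on the line k t the singular term is at most
m / k^(p' - 1), constant in t; under the condition on c the line grows no faster
than the equation asks for, and it lies above the solution at 1. *)
Lemma desingularize_le_linear (c m hM k : R) y : terminal_solution c y -> 0 < m ->
  {in `]0, 1[, forall t, f t <= m * t `^ (p' - 1)} ->
  (forall t, 0 <= t <= 1 -> h t <= hM) -> 0 < k ->
  hM + k + m / k `^ (p' - 1) <= c ->
  forall t, 0 <= t <= 1 -> desingularize y t <= k * t.
Proof.
move=> yP m0 f_le hhM k0 kc t t01.
have := backward_comparison 0 1 (fun s => desingularize y s - cst 0 s + (- k * s + 0)).
move=> /(_ _ _ _ _ t t01) H.
have {H} : desingularize y t - 0 + (- k * t + 0) <= 0; last lra.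
apply: H.
- apply: within_continuous_perturb; first exact: desingularize_continuous yP.
  exact: ac_continuous (ac_cst 0 1 0).
- move=> s u s0 su u1; apply: ac_perturb; last exact: ac_cst.
  exact: desingularize_ac yP _ _ s0 su u1.
- apply: aeS (desingularize_derive _ _ yP) => s ds s01 wks.
  eexists; first last.
    by apply: (is_derive_perturb s (- k) 0 _ 0); exact: ds.
  have [_ _ _ /(_ s s01) ys] := yP.
  have /andP[s0 s1] : 0 < s < 1 by move: s01; rewrite in_itv.
  have ks : 0 < k * s by rewrite mulr_gt0.
  (* y > (k s)^p', hence y^(1/p) > (k s)^(p'-1) *)
  have ksy : (k * s) `^ (p' - 1) <= y s `^ q.
    have [_ _ ->] := conj_exponentE p p_gt1; rewrite powRrM.
    apply: ge0_ler_powR; rewrite ?nnegrE ?powR_ge0 ?(ltW ys) ?(ltW q_gt0)//.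
    have -> : y s = (y s `^ q') `^ p'.
      by rewrite -powRrM mulVf ?gt_eqF// powRr1// ltW.
    apply: ge0_ler_powR; rewrite ?nnegrE ?powR_ge0 ?(ltW ks) ?(ltW p'_gt0)//.
    by move: wks; rewrite /desingularize/= /posroot pos_part_id ?(ltW ys)//; lra.
  have fs : f s / y s `^ q <= m / k `^ (p' - 1).
    rewrite ler_pdivrMr ?powR_gt0//; apply: le_trans (f_le _ s01) _.
    rewrite powRM ?(ltW k0) ?(ltW s0)// in ksy.
    apply: (@le_trans _ _ (m / k `^ (p' - 1) * (k `^ (p' - 1) * s `^ (p' - 1)))).
      by rewrite mulrA divfK// gt_eqF// powR_gt0.
    by apply: ler_wpM2l => //; rewrite divr_ge0 ?powR_ge0// ltW.
  have hs : h s <= hM by apply: hhM; rewrite !ltW.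
  lra.
- by rewrite /= (desingularize1 _ _ yP); lra.
Qed.

End comparison.

(** * Lower bounds on the speed *)

Section lower_bounds.
Context {R : realType}.
Local Notation mu := (@lebesgue_measure R).

Variables (p : R) (f h : R -> R).
Hypothesis p_gt1 : 1 < p.
Hypothesis f_gt0 : {in `]0, 1[, forall t, 0 < f t}.

Variables (c : R) (y : R -> R).
Hypotheses (yP : terminal_solution p f h c y) (y0 : y 0 = 0).

(** If c < h 0, then c - h is negative just after 0, so that y' <= 0 there and y
cannot leave 0 upward. *)
Lemma speed_ge_h0 : h t @[t --> 0^'+] --> h 0 -> h 0 <= c.
Proof.
move=> h_cont0; rewrite leNgt; apply/negP => ch.
have [[acy dy] _ _ ypos] := yP.
have : \forall t \near 0^'+, c < h t by exact: (cvgr_gt _ h_cont0).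
rewrite near_withinE => /nbhs_ballP[r /= r0 rP].
have hc t : 0 < t < r -> c < h t.
  move=> /andP[t0 tr]; apply: rP => //.
  by rewrite /ball/= sub0r normrN gtr0_norm.
pose d := Num.min (r / 2) 2^-1.
have dr : d < r.
  have : d <= r / 2 by rewrite /d ge_min lexx.
  lra.
have d1 : d < 1.
  have : d <= 2^-1 by rewrite /d ge_min lexx orbT.
  lra.
have d0 : 0 < d by rewrite /d lt_min invr_gt0 ltr0n andbT divr_gt0.
have : (\- y) 0 <= (\- y) d.
  apply: ac_nondecreasing; first exact: ltW.
    by apply: acN; apply: ac_sub acy => //; exact: ltW.
  apply: aeS dy => t dt; rewrite in_itv/= => /andP[t0 td].
  have t01 : t \in `]0, 1[ by rewrite in_itv/= t0/=; lra.
  eexists; last exact: is_deriveN (dt t01).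
  have p'0 : 0 < conj_exponent p by have [/(lt_trans ltr01)] := conj_exponentE p p_gt1.
  rewrite oppr_ge0 pmulr_rle0// subr_le0; apply: le_trans (ltW (f_gt0 _ t01)).
  by apply: mulr_le0_ge0; [rewrite subr_le0 ltW// hc// t0/=; lra|exact: powR_ge0].
rewrite /= y0 oppr0 oppr_ge0 leNgt => /negP; apply; apply: ypos.
by rewrite in_itv/= d0.
Qed.

(** Integrating w' = c - h - f / y^(1/p) over ]0, 1[, at the ends of which w
vanishes, gives c - H(1) as the integral of f / y^(1/p) > 0. That integral may be
improper, so the argument is run on the function D, whose derivative is
f / y^(1/p): D is nondecreasing, and it is not constant. *)
Lemma speed_gt_mean (C0 : R) : measurable_fun (`[0, 1]%classic : set R) h ->
  (forall t, 0 <= t <= 1 -> `|h t| <= C0) ->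
  \int[mu]_(s in `[0, 1]) h s < c.
Proof.
move=> h_meas h_le.
pose g := h \_ `[0, 1]%classic.
have gE t : 0 <= t <= 1 -> g t = h t.
  by move=> t01; rewrite /g patchE mem_set//= in_itv.
have gb : bounded_on_itv 0 1 C0 g.
  split; first exact/(measurable_restrictT _ _).1.
  - move=> t; rewrite /g patchE; case: ifPn => [|_].
      by rewrite inE/= in_itv/= => /h_le.
    by rewrite normr0; apply: le_trans (h_le 0 _); rewrite ?lexx ?ler01.
  - by move=> t t01; rewrite /g patchE memNset//= in_itv; exact/negP.
have gint : primitive g 1 - primitive g 0 = \int[mu]_(s in `[0, 1]) h s.
  rewrite (primitiveB 0 1 C0 g 0 1 gb ler01).
  rewrite Rintegral_itv_obnd_cbnd; last exact: bounded_on_itv_integrable gb.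
  by apply: eq_Rintegral => t; rewrite inE/= in_itv/=; exact: gE.
have acg a b : absolutely_continuous a b (primitive g).
  by apply: (ac_lipschitz a b _ C0) => s t _ st _; exact: primitive_lipschitz gb st.
pose w := desingularize p y.
pose D k e s := (\- w) s - primitive g s + (k * s + e).
have DE k e s : D k e s = - w s - primitive g s + (k * s + e) by [].
have Dc b e : b <= 1 -> {within `[0, b], continuous (D c e)}.
  move=> b1; apply: within_continuous_perturb; last first.
    exact: ac_continuous (acg 0 b).
  have cw : {within `[0, 1], continuous (\- w)}.
    by move=> x; apply: continuousN; exact: (desingularize_continuous _ _ _ p_gt1 _ _ yP).
  apply: continuous_subspaceW cw.
  by move=> x /=; rewrite !in_itv/= => /andP[-> xb]; lra.
have Dac e s t : 0 < s -> s <= t -> t < 1 -> absolutely_continuous s t (D c e).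
  move=> s0 st t1; apply: ac_perturb; last exact: acg.
  by apply: acN; exact: desingularize_ac p_gt1 _ _ yP _ _ s0 st t1.
have Dd e : {ae mu, forall t : R, t \in `]0, 1[ ->
    is_derive t 1 (D c e) (f t / y t `^ p^-1)}.
  apply: aeS2 (desingularize_derive _ _ _ p_gt1 _ _ yP) (primitive_derive 0 1 C0 g gb).
  move=> t dw dg t01; have {}dw := is_deriveN (dw t01).
  apply: is_derive_eq (is_derive_perturb t c e _ _ _ _ dw dg) _.
  by rewrite gE; [ring|move: t01; rewrite in_itv/= => /andP[? ?]; rewrite !ltW].
have fy_gt0 t : t \in `]0, 1[ -> 0 < f t / y t `^ p^-1.
  by move=> t01; have [_ _ _ ypos] := yP; rewrite divr_gt0 ?f_gt0 ?powR_gt0 ?ypos.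
have Dmono s t : 0 <= s -> s <= t -> t <= 1 -> D c 0 s <= D c 0 t.
  move=> s0 st t1.
  have := backward_comparison 0 t (D c (- D c 0 t)) (Dc t _ t1) _ _ _ s.
  rewrite s0 st => H.
  suff : D c (- D c 0 t) s <= 0 by rewrite !DE; lra.
  apply: H => //.
  - by move=> u v u0 uv vt; apply: Dac => //; exact: lt_le_trans t1.
  - apply: aeS (Dd _) => u du; rewrite in_itv/= => /andP[u0 ut] _.
    have u01 : u \in `]0, 1[ by rewrite in_itv/= u0/=; lra.
    by eexists; [|exact: du]; exact/ltW/fy_gt0.
  - by rewrite !DE; lra.
have w0 : w 0 = 0 by apply/eqP; rewrite desingularize_eq0// y0.
have w1 : w 1 = 0 by exact: desingularize1 p_gt1 _ _ yP.
have D01 : D c 0 1 - D c 0 0 = c - \int[mu]_(s in `[0, 1]) h s.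
  by rewrite -gint !DE w0 w1; ring.
rewrite ltNge; apply/negP => cH.
(* otherwise D is constant, although its derivative is positive a.e. *)
have Dcst t : 0 <= t <= 1 -> D c 0 t = D c 0 0.
  move=> /andP[t0 t1].
  have := Dmono 0 t (lexx _) t0 t1; have := Dmono t 1 t0 t1 (lexx _).
  lra.
(* Almost every t in ]0, 1[ turns out to be contradictory, and then every
   absolutely continuous function is nondecreasing, - id included. *)
suff : (fun s : R => - s) 0 <= (fun s : R => - s) 1 by rewrite /=; lra.
apply: ac_nondecreasing; first exact: ler01.
  by apply: (ac_lipschitz 0 1 _ 1) => s t _ st _; rewrite -opprD normrN ger0_norm; lra.
apply: aeS (Dd 0) => t dt t01; exfalso.
have /andP[t0 t1] : 0 < t < 1 by move: t01; rewrite in_itv.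
have d0 : is_derive t 1 (D c 0) 0.
  apply: (near_eq_is_derive (f := cst (D c 0 0))).
  near=> s; rewrite Dcst//; apply/andP; split.
    by apply/ltW; near: s; exact: lt_nbhsr.
  by apply/ltW; near: s; exact: lt_nbhsl.
have := fy_gt0 t t01; have [_ <-] := dt t01; have [_ ->] := d0.
by rewrite ltxx.
Unshelve. all: by end_near. Qed.

End lower_bounds.

(** * The threshold *)

Section threshold.
Context {R : realType}.

Lemma closed_up_set_ray (C : set R) (l u : R) : C u -> (forall c, C c -> l <= c) ->
  (forall c1 c2, c1 <= c2 -> C c1 -> C c2) ->
  (forall c, (forall e, 0 < e -> C (c + e)) -> C c) ->
  exists2 cs, C cs /\ cs <= u & forall c, C c <-> cs <= c.
Proof.
move=> Cu Cl up cl.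
have hiC : has_inf C by split; [exists u|exists l => c; exact: Cl].
have infC : C (inf C).
  apply: cl => e e0; have [c Cc ce] := inf_adherent e0 hiC.
  by apply: up Cc; exact: ltW.
exists (inf C); first by split => //; apply: ge_inf => //; exact: (proj2 hiC).
move=> c; split => [Cc|]; last by move=> /up; apply.
by apply: ge_inf => //; exact: (proj2 hiC).
Qed.

(** The slope minimizing k + mu k^(1 - p'): k^p' = (p' - 1) mu, and then the minimum
is k p. *)
Lemma optimal_slope (p mu : R) : 1 < p -> 0 < mu ->
  let p' := conj_exponent p in
  exists2 k, 0 < k &
    k + mu / k `^ (p' - 1) = p' `^ p'^-1 * p `^ p^-1 * mu `^ p'^-1.
Proof.
move=> p1 mu0 p'; have [p'1 q'E p'E] := conj_exponentE p p1.
rewrite -/p' in p'1 q'E p'E.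
have p0 : 0 < p by lra.
have p'0 : 0 < p' by lra.
have a0 : 0 < p' * p^-1 by rewrite divr_gt0.
pose k := (p' * p^-1 * mu) `^ p'^-1.
have k0 : 0 < k by rewrite powR_gt0// mulr_gt0.
exists k => //.
have kp' : k `^ p' = p' * p^-1 * mu.
  by rewrite /k -powRrM mulVf ?gt_eqF// powRr1// mulr_ge0// ltW.
have -> : k + mu / k `^ (p' - 1) = k * p.
  rewrite powRB ?(gt_eqF k0) ?implybT// powRr1 ?(ltW k0)// kp'.
  have pp' : p' = p / (p - 1) by [].
  rewrite pp'; field; rewrite !gt_eqF//; lra.
have pV0 : 0 <= p^-1 by rewrite invr_ge0 ltW.
have -> : k = p' `^ p'^-1 * p^-1 `^ p'^-1 * mu `^ p'^-1.
  by rewrite /k powRM ?(ltW a0) ?(ltW mu0)// powRM// ltW.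
have -> : p^-1 `^ p'^-1 = p `^ p^-1 / p.
  have pV : p `^ p'^-1 * p^-1 `^ p'^-1 = 1.
    by rewrite -powRM ?invr_ge0 ?(ltW p0)// divff ?gt_eqF// powR1.
  have pq : p `^ p'^-1 = p / p `^ p^-1.
    by rewrite q'E powRB ?(gt_eqF p0) ?implybT// powRr1// ltW.
  apply: (@mulfI _ (p `^ p'^-1)); first by rewrite gt_eqF// powR_gt0.
  by rewrite pV pq; field; rewrite !gt_eqF// powR_gt0.
by field; rewrite gt_eqF.
Qed.

End threshold.

Theorem theorem4p1 (R : realType) (p : R) (f h : R -> R) (mu : R)
  (p_gt1 : 1 < p)
  (f_gt0 : {in `]0, 1[, forall t, 0 < f t})
  (f_lsc : lower_semicontinuous_on `]0, 1[ f)
  (h_cont0 : h t @[t --> 0^'+] --> h 0)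
  (h_bounded : [bounded h t | t in `[0, 1]])
  (h_pc : piecewise_continuous01 h)
  (mu_gt0 : 0 < mu)
  (mu_sup : ereal_sup
     [set (f t / t `^ (conj_exponent p - 1))%:E | t in `]0, 1[] = mu%:E) :
  let p' := conj_exponent p in
  let H1 := \int[@lebesgue_measure R]_(s in `[0, 1]) h s in
  let hM := sup [set h t | t in `[0, 1]] in
  let cM := hM + p' `^ p'^-1 * p `^ p^-1 * mu `^ p'^-1 in
  (H1 < h 0 ->
     exists2 cstar : R, cstar \in `[h 0, cM] &
       forall c : R, has_unique_positive_solution p f h c <-> cstar <= c) /\
  (h 0 <= H1 ->
     exists2 cstar : R, cstar \in `]H1, cM] &
       forall c : R, has_unique_positive_solution p f h c <-> cstar <= c).
Proof.
move=> p' H1 hM cM.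
have [C0 [_ /(_ (C0 + 1)) h_le']] := h_bounded.
have h_le t : 0 <= t <= 1 -> `|h t| <= C0 + 1.
  by move=> t01; apply: h_le'; rewrite ?ltrDl//= in_itv.
have h_meas := piecewise_continuous01_measurable h h_pc.
have f_le : {in `]0, 1[, forall t, f t <= mu * t `^ (p' - 1)}.
  move=> t t01; have t0 : 0 < t by move: t01; rewrite in_itv/= => /andP[].
  rewrite -ler_pdivrMr ?powR_gt0// -lee_fin -mu_sup.
  by apply: ereal_sup_ubound; exists t.
have hhM t : 0 <= t <= 1 -> h t <= hM.
  move=> t01; apply: ub_le_sup; last by exists t => //=; rewrite in_itv.
  exists (C0 + 1) => _ [s s01 <-]; apply: le_trans (ler_norm _) (h_le s _).
  by move: s01; rewrite /= in_itv.
have [Y YP] : exists Y : R -> R -> R, forall c, terminal_solution p f h c (Y c).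
  suff /choice[Y YP] : forall c, exists y, terminal_solution p f h c y by exists Y.
  move=> c; have [y solY Y1] := caratheodory_solution_exists p mu (C0 + 1) f h
    p_gt1 f_gt0 f_lsc mu_gt0 f_le h_meas h_le c.
  exists y; split => //.
    by apply: (caratheodory_solution_ge0 p f h p_gt1 f_gt0 c); rewrite ?lexx ?ler01.
  exact: (caratheodory_solution_gt0 p (C0 + 1) f h p_gt1 f_gt0 f_lsc h_le c).
pose C c := Y c 0 = 0.
have solC c : has_unique_positive_solution p f h c <-> C c.
  split=> [[y [[acy dy y0 y1] ypos] _]|Yc0].
    have yT : terminal_solution p f h c y by split => //; rewrite y0.
    apply: etrans y0.
    apply: (terminal_solution_unique p f h p_gt1 f_gt0 c _ _ (YP c) yT).
    by rewrite in_itv/= lexx ler01.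
  have [[acY dY] Y1 _ Ypos] := YP c.
  exists (Y c); first by split.
  move=> z [[acz dz z0 z1] zpos].
  apply: (terminal_solution_unique p f h p_gt1 f_gt0 c z _ _ (YP c)).
  by split => //; rewrite z0.
pose w c := desingularize p (Y c) 0.
have wC c : C c <-> w c = 0.
  have [_ _ Y0 _] := YP c.
  have wY := desingularize_eq0 p p_gt1 (Y c) 0 Y0.
  by rewrite /C /w; split=> /eqP; [rewrite -wY|rewrite wY] => /eqP.
have w_ge0 c : 0 <= w c by exact: desingularize_ge0.
have O01 : 0 <= (0 : R) <= 1 by rewrite lexx ler01.
have wmono c1 c2 : c1 <= c2 -> w c2 <= w c1.
  move=> c12.
  exact: (desingularize_nonincreasing p f h p_gt1 f_gt0 c1 c2 _ _ c12 (YP c1) (YP c2)).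
have wlip c1 c2 : c1 <= c2 -> w c1 <= w c2 + (c2 - c1).
  move=> c12; rewrite -[c2 - c1]mulr1 -[in X in _ <= _ + _ * X](subr0 1).
  exact: (desingularize_lipschitz p f h p_gt1 f_gt0 c1 c2 _ _ c12 (YP c1) (YP c2)).
have CcM : C cM.
  have [k k0 kE] := optimal_slope p mu p_gt1 mu_gt0.
  apply/wC/le_anti; rewrite w_ge0 andbT -(mulr0 k).
  apply: (desingularize_le_linear p f h p_gt1 cM mu hM k (Y cM)) => //.
  by rewrite -addrA kE.
have Cup c1 c2 : c1 <= c2 -> C c1 -> C c2.
  move=> c12 /wC w1; apply/wC/le_anti; rewrite w_ge0 andbT -w1; exact: wmono.
have Ccl c : (forall e, 0 < e -> C (c + e)) -> C c.
  move=> Ce; apply/wC/le_anti; rewrite w_ge0 andbT.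
  apply/ler_addgt0Pr => e e0; have /wC we := Ce e e0.
  have ce : c <= c + e by rewrite lerDl ltW.
  by have := wlip c (c + e) ce; rewrite we; lra.
have ge_h0 c : C c -> h 0 <= c.
  by move=> Cc; exact: (speed_ge_h0 p f h p_gt1 f_gt0 c (Y c) (YP c) Cc h_cont0).
have gt_H1 c : C c -> H1 < c.
  by move=> Cc; exact: (speed_gt_mean p f h p_gt1 f_gt0 c (Y c) (YP c) Cc (C0 + 1)).
have [cs [Ccs csM] csP] := closed_up_set_ray C (h 0) cM CcM ge_h0 Cup Ccl.
split=> _; exists cs.
- by rewrite in_itv/= csM ge_h0.
- by move=> c; apply: iff_trans (solC c) (csP c).
- by rewrite in_itv/= csM gt_H1.
- by move=> c; apply: iff_trans (solC c) (csP c).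
Qed.
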